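(* Consider the impulsive control system $$\dot x(t)=f(x(t)),\ t\neq t_k+\tau;\qquad \Delta x(t_k+\tau)=g(x(t_k)),\ k\in\mathbb{N};\qquad x(0)=x_0,$$ with the event times $\{t_k\}_{k\in\mathbb{N}}$ determined, for positive constants $a$ and $b$, by $$t_{1}=\inf\{t\ge 0: V(x(t))\ge a e^{-bt}\},\qquad t_{k+1}=\inf\{t\ge t_k+\tau: V(x(t))\ge a e^{-bt}\}\ \text{ for } k\ge 1 .$$ Suppose that there exists some $R>0$ such that Assumptions A and B (stated in the context) hold on $\mathcal{B}(R)$, with the constants $L_1,L_2,\mu,\rho>0$ and functions $V\in\mathcal V$, $\alpha_1,\alpha_2\in\mathcal{K}_\infty$ appearing there. If $\rho<1$, $a<\alpha_1(R)$, and $0\le\tau<\min\{\varepsilon_1,\varepsilon_2\}$ with $$\varepsilon_1=\frac1\mu\ln\left(\frac{\alpha_1(R)}{a}\right),\qquad \varepsilon_2=\frac1b\ln\left(\frac1\rho\right),$$ satisfy $$L_2+\sqrt{\frac{\tau L_1\left(e^{2L_1\tau}-1\right)}{2}}<\frac{R}{\alpha_1^{-1}(a)},$$ then, for any initial state $x_0\in\mathcal{B}(\alpha_2^{-1}(a))$, the inter-event times $\{t_{k+1}-t_k\}_{k\in\mathbb{N}}$ are lower bounded by $$\Gamma:=\tau-\frac{\ln(\rho e^{b\tau})}{b+\mu}>\tau,$$ that is, $t_{k+1}-t_k\ge\Gamma$ for all $k\in\mathbb{N}$. Moreover, the trivial solution of the system is asymptotically stable.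
   Context: Notation. $\mathbb{N}$ is the set of positive integers, $\mathbb{R}^+=[0,\infty)$, $\|\cdot\|$ is the Euclidean norm on $\mathbb{R}^n$, and $\mathcal{B}(r)=\{x\in\mathbb{R}^n:\|x\|<r\}$. $\mathcal V$ is the set of locally Lipschitz continuous functions $\mathbb{R}^n\to\mathbb{R}^+$. A continuous function $\alpha:\mathbb{R}^+\to\mathbb{R}^+$ is of class $\mathcal{K}_\infty$ if it is strictly increasing, $\alpha(0)=0$, and $\alpha(s)\to\infty$ as $s\to\infty$; $\alpha^{-1}$ denotes its inverse. System. $x(t)\in\mathbb{R}^n$ is the state, $x_0\in\mathbb{R}^n$ the initial state, $f:\mathbb{R}^n\to\mathbb{R}^n$ is continuous with $f(0)=0$, $g:\mathbb{R}^n\to\mathbb{R}^n$ satisfies $g(0)=0$, and $\tau\in\mathbb{R}^+$ is the actuation delay. The times $t_k$ are the event times (the impulsive control input is updated), and the times $t_k+\tau$ are the impulse times (the state jumps). $\Delta x(t):=x(t^+)-x(t^-)$, where $x(t^+)$ and $x(t^-)$ are the right and left limits; $x$ is right continuous at each impulse time, so $x(t_k+\tau)=x((t_k+\tau)^-)+g(x(t_k))$; when $\tau=0$ this is read with the pre-jump state, $x(t_k)=x(t_k^-)+g(x(t_k^-))$. The function $V$ in the event-time rule is the one in Assumption B. The infimum of the empty set is $\infty$; if $t_{k+1}=\infty$, no further events or impulses occur after time $t_k+\tau$ (none at all if $t_1=\infty$), and the inter-event bounds concern events that actually occur. The event times depend on the solution, hence on $x_0$. Dini derivative. For $V\in\mathcal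 V$, $\mathrm{D}^+V(x)=\limsup_{h\to0^+}\frac{V(x+hf(x))-V(x)}{h}$. Assumption A (on $\mathcal{B}(R)$). There exist positive constants $L_1$ and $L_2$ such that for all $x\in\mathcal{B}(R)$: $\|f(x)\|\le L_1\|x\|$ and $\|x+g(x)\|\le L_2\|x\|$. Assumption B (on $\mathcal{B}(R)$). There exist $V\in\mathcal V$, $\alpha_1,\alpha_2\in\mathcal{K}_\infty$, and positive constants $\mu$ and $\rho$ such that for any $x\in\mathcal{B}(R)$: (i) $\alpha_1(\|x\|)\le V(x)\le\alpha_2(\|x\|)$; (ii) $\mathrm{D}^+V(x)\le\mu V(x)$; (iii) if $y\in\mathcal{B}(R)$ and $y+g(x)\in\mathcal{B}(R)$, then $V(y+g(x))\le\rho V(x)$, where $y=z(\tau)$ and $z(t)$ is the solution of the initial value problem $\dot z(t)=f(z(t))$, $z(0)=x$. Stability. Write $x(t)=x(t,0,x_0)$ for the solution of the system. The trivial solution is stable if for any $\varepsilon>0$ there exists $\sigma=\sigma(\varepsilon)>0$ such that $\|x_0\|<\sigma$ implies $\|x(t)\|<\varepsilon$ for all $t\ge0$. It is asymptotically stable if it is stable and there exists $\sigma>0$ such that $\|x_0\|<\sigma$ implies $\lim_{t\to\infty}\|x(t)\|=0$. *)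

(* Defs.v *)
From HB Require Import structures.
From mathcomp Require Import all_boot all_order all_algebra.
From mathcomp Require Import all_classical all_reals all_analysis.

Set Implicit Arguments.
Unset Strict Implicit.
Unset Printing Implicit Defensive.

Import Order.TTheory GRing.Theory Num.Theory numFieldNormedType.Exports.

Local Open Scope classical_set_scope.
Local Open Scope ring_scope.

(* The library norm `|x| on row vectors is the sup norm, hence the explicit
   Euclidean norm. Continuity, limits, derivatives and the local Lipschitz
   property below use the library structure, which is equivalent in finite
   dimension. *)
Definition enorm (R : realType) (n : nat) (x : 'rV[R]_n) : R :=
  Num.sqrt (\sum_(i < n) x ord0 i ^+ 2).

Definition eball (R : realType) (n : nat) (r : R) : set 'rV[R]_n :=
  [set x | enorm x < r].

Definition class_V (R : realType) (n : nat) (V : 'rV[R]_n -> R) : Prop :=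
  (forall x, 0 <= V x) /\
  (forall x : 'rV[R]_n, exists2 U : set 'rV[R]_n,
     nbhs x U & [lipschitz V y | y in U]).

(* Functions on [0, +oo[ are represented by functions on R of which only the
   restriction to [0, +oo[ matters. *)
Definition class_Koo (R : realType) (alpha : R -> R) : Prop :=
  [/\ {within `[0, +oo[, continuous alpha},
      {in `[0, +oo[ &, {homo alpha : s t / s < t}},
      alpha 0 = 0 &
      alpha s @[s --> +oo] --> +oo].

Definition Koo_inv (R : realType) (alpha : R -> R) : R -> R :=
  'pinv_(fun=> 0) `[0, +oo[ alpha.

Definition dini (R : realType) (n : nat) (f : 'rV[R]_n -> 'rV[R]_n)
    (V : 'rV[R]_n -> R) (x : 'rV[R]_n) : \bar R :=
  limf_esup (fun h : R => ((V (x + h *: f x) - V x) / h)%:E) 0^'+.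

Definition ivp_solution (R : realType) (n : nat) (f : 'rV[R]_n -> 'rV[R]_n)
    (tau : R) (x : 'rV[R]_n) (z : R -> 'rV[R]_n) : Prop :=
  [/\ z 0 = x,
      {within `[0, tau], continuous z} &
      forall t : R, 0 < t < tau -> is_derive t 1 z (f (z t))].

Definition assumptionA (R : realType) (n : nat) (f g : 'rV[R]_n -> 'rV[R]_n)
    (L1 L2 r : R) : Prop :=
  [/\ 0 < L1, 0 < L2 &
      forall x, eball r x ->
        enorm (f x) <= L1 * enorm x /\ enorm (x + g x) <= L2 * enorm x].

(* As f is only continuous, the initial value problem in the last clause may
   have several solutions: the clause is required of each of them. *)
Definition assumptionB (R : realType) (n : nat) (f g : 'rV[R]_n -> 'rV[R]_n)
    (tau : R) (V : 'rV[R]_n -> R) (alpha1 alpha2 : R -> R) (mu rho r : R)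
    : Prop :=
  [/\ class_V V, class_Koo alpha1 /\ class_Koo alpha2, 0 < mu, 0 < rho &
      forall x, eball r x ->
        [/\ alpha1 (enorm x) <= V x <= alpha2 (enorm x),
            (dini f V x <= (mu * V x)%:E)%E &
            forall z, ivp_solution f tau x z ->
              eball r (z tau) -> eball r (z tau + g x) ->
              V (z tau + g x) <= rho * V x]].

Section ImpulsiveSystem.
Context (R : realType) (n : nat).
Variables (f g : 'rV[R]_n -> 'rV[R]_n) (V : 'rV[R]_n -> R) (a b tau : R).

(* A trajectory lives on [0, T[ with T possibly infinite; the values of x
   outside [0, T[ are irrelevant. *)
Variables (x0 : 'rV[R]_n) (T : \bar R) (x : R -> 'rV[R]_n).

(* x(t^-), with the convention x(0^-) = x0 *)
Definition left_state (t : R) : 'rV[R]_n :=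
  if t <= 0 then x0 else lim (x s @[s --> t^'-]).

(* The state seen by the controller at time t. Without delay, an event and its
   impulse are simultaneous and the controller sees the pre-jump state. *)
Definition sampled_state (t : R) : 'rV[R]_n :=
  if tau == 0 then left_state t else x t.

Definition triggers (y : 'rV[R]_n) (t : R) : Prop :=
  a * expR (- b * t) <= V y.

(* event_time k is the (k+1)-st event time. At the beginning t = t_k + tau of
   a search interval, the state is x(t) itself: it is post-jump even when
   tau = 0. An infinite event_time k makes event_time k.+1 infinite. *)
Fixpoint event_time (k : nat) : \bar R :=
  if k is k'.+1 then
    ereal_inf [set t%:E | t in [set t : R |
      [/\ (event_time k' + tau%:E <= t%:E)%E, (t%:E < T)%E &
          triggers (if t%:E == (event_time k' + tau%:E)%E then x t
                    else sampled_state t) t]]]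
  else
    ereal_inf [set t%:E | t in [set t : R |
      [/\ 0 <= t, (t%:E < T)%E & triggers (sampled_state t) t]]].

Definition impulse_time (t : R) : Prop :=
  exists k, (event_time k + tau%:E)%E = t%:E.

Definition solution : Prop :=
  [/\ (0 < T)%E,
      ~ impulse_time 0 -> x 0 = x0,
      forall t : R, 0 < t -> (t%:E < T)%E -> ~ impulse_time t ->
        is_derive t 1 x (f (x t)),
      forall t, (t = 0 \/ 0 < t /\ impulse_time t) -> (t%:E < T)%E ->
        x s @[s --> t^'+] --> x t &
      forall k t, event_time k = t%:E -> ((t + tau)%:E < T)%E ->
        (0 < t + tau -> cvg (x s @[s --> (t + tau)^'-])) /\
        x (t + tau) = left_state (t + tau) + g (sampled_state t)].

End ImpulsiveSystem.

(* Stability of the origin for a family of trajectories: sol x0 T x means that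
   x is a trajectory on [0, T[ with initial state x0. *)
Definition stable (R : realType) (n : nat)
    (sol : 'rV[R]_n -> \bar R -> (R -> 'rV[R]_n) -> Prop) : Prop :=
  forall eps : R, 0 < eps -> exists2 sigma : R, 0 < sigma &
    forall x0 T x, enorm x0 < sigma -> sol x0 T x ->
    forall t : R, 0 <= t -> (t%:E < T)%E -> enorm (x t) < eps.

Definition attractive (R : realType) (n : nat)
    (sol : 'rV[R]_n -> \bar R -> (R -> 'rV[R]_n) -> Prop) : Prop :=
  exists2 sigma : R, 0 < sigma &
    forall x0 x, enorm x0 < sigma -> sol x0 +oo%E x ->
    enorm (x t) @[t --> +oo] --> 0.

Definition asymptotically_stable (R : realType) (n : nat)
    (sol : 'rV[R]_n -> \bar R -> (R -> 'rV[R]_n) -> Prop) : Prop :=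
  stable sol /\ attractive sol.

(* Main.v *)
(* Along the flow, the Dini bound gives V(x(t)) <= V(x(s)) e^(mu (t - s)), and a
   trajectory on which V stays below some c < alpha1(R) cannot leave B(R).
   Before the event t_k nothing triggers, so V <= a e^(-bt) <= a; at the event
   V = a e^(-b t_k); during the delay V grows by at most the factor e^(mu tau),
   which keeps the state in B(R). The impulse then resets V to at most
   rho a e^(-b t_k) < a e^(-b (t_k + tau)), and V needs a further time
   Gamma - tau to climb back to the threshold. As the gaps are at least
   Gamma > 0, the search intervals cover the whole domain and
   V(x(t)) <= a e^((b + mu) tau) e^(-bt), which gives attractivity. For
   stability, a small V(x0) postpones the first event past any given time.
   Leaving the ball through an impulse is excluded by
   |z(tau) - x| <= |x| (e^(L1 tau) - 1), which is sharper than the square root in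
   the hypothesis. *)
Require Import Defs.
From mathcomp Require Import all_boot all_order all_algebra.
From mathcomp Require Import all_classical all_reals all_analysis.
From mathcomp Require Import ring lra.
Import Order.TTheory GRing.Theory Num.Theory numFieldNormedType.Exports.
Local Open Scope classical_set_scope.
Local Open Scope ring_scope.

(** * Euclidean norm and class K-infinity functions *)

Section EuclideanNorm.
Context {R : realType} {n : nat}.
Implicit Types x y : 'rV[R]_n.

Lemma enorm_ge0 x : 0 <= enorm x.
Proof. exact: sqrtr_ge0. Qed.

Lemma enorm0 : enorm (0 : 'rV[R]_n) = 0.
Proof.
by rewrite /enorm big1 ?sqrtr0// => i _; rewrite mxE expr0n.
Qed.

Lemma enormZ (c : R) x : enorm (c *: x) = `|c| * enorm x.
Proof.
rewrite /enorm -sqrtr_sqr -sqrtrM ?sqr_ge0// mulr_sumr.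
by congr Num.sqrt; apply: eq_bigr => i _; rewrite mxE exprMn.
Qed.

(** With X and Y the squared norms of x and y and P the inner product, Y (X Y - P^2) equals the sum
    of the squares (Y x_i - P y_i)^2, hence is nonnegative. One divides by Y, or has y = 0. *)
Lemma cauchy_schwarz x y :
  \sum_(i < n) x ord0 i * y ord0 i <= enorm x * enorm y.
Proof.
set P := \sum_(i < n) _.
rewrite /enorm -sqrtrM; last by apply: sumr_ge0 => i _; exact: sqr_ge0.
set X := \sum_(i < n) _; set Y := \sum_(i < n) _.
apply: le_trans (ler_norm P) _; rewrite -sqrtr_sqr ler_wsqrtr//.
have Y0 : 0 <= Y by apply: sumr_ge0 => i _; exact: sqr_ge0.
have : 0 <= Y * (X * Y - P ^+ 2).
  have -> : Y * (X * Y - P ^+ 2) =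
      \sum_(i < n) (Y * x ord0 i - P * y ord0 i) ^+ 2.
    rewrite (eq_bigr (fun i => Y ^+ 2 * x ord0 i ^+ 2
      - (2 * Y * P) * (x ord0 i * y ord0 i) + P ^+ 2 * y ord0 i ^+ 2)).
      by rewrite big_split sumrB -!mulr_sumr -/X -/Y -/P /=; ring.
    by move=> i _; ring.
  by apply: sumr_ge0 => i _; exact: sqr_ge0.
case: (eqVneq Y 0) => [Y_eq0 _|Y_neq0]; last first.
  by rewrite pmulr_rge0 ?subr_ge0// lt_neqAle eq_sym Y_neq0.
have yi0 i : y ord0 i = 0.
  apply/eqP; rewrite -sqrf_eq0.
  move/eqP: Y_eq0; rewrite psumr_eq0; last by move=> j _; exact: sqr_ge0.
  by move=> /allP/(_ i); rewrite mem_index_enum => /(_ isT).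
rewrite /P big1 ?expr0n/= ?mulr_ge0//; last by move=> i _; rewrite yi0 mulr0.
by apply: sumr_ge0 => i _; exact: sqr_ge0.
Qed.

Lemma enormD x y : enorm (x + y) <= enorm x + enorm y.
Proof.
have sq z : enorm z ^+ 2 = \sum_(i < n) z ord0 i ^+ 2.
  by rewrite sqr_sqrtr//; apply: sumr_ge0 => i _; exact: sqr_ge0.
rewrite -(@ler_pXn2r _ 2)// ?nnegrE ?addr_ge0 ?enorm_ge0//.
rewrite sqrrD !sq; under eq_bigr do rewrite mxE sqrrD.
by rewrite !big_split/= lerD2r lerD2l mulr2n lerD// cauchy_schwarz.
Qed.

Lemma enormN x : enorm (- x) = enorm x.
Proof. by rewrite -scaleN1r enormZ normrN1 mul1r. Qed.

Lemma enormBD x y : enorm x <= enorm (x - y) + enorm y.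
Proof. by rewrite -{1}(subrK y x) enormD. Qed.

Lemma ler_dist_enorm x y : `|enorm x - enorm y| <= enorm (x - y).
Proof.
rewrite ler_distl; have := enormBD x y; have := enormBD y x.
rewrite -[enorm (y - x)]enormN opprB => yx xy.
by rewrite [X in _ && (_ <= X)]addrC xy andbT lerBlDr addrC.
Qed.

(** Transfers convergence and derivatives, which are stated for the sup norm, to the Euclidean
    norm. *)
Lemma enorm_le_norm x : enorm x <= Num.sqrt n%:R * `|x|.
Proof.
have -> : Num.sqrt n%:R * `|x| = Num.sqrt (\sum_(i < n) `|x| ^+ 2).
  rewrite sumr_const card_ord -[in RHS]mulr_natl sqrtrM ?ler0n//.
  by rewrite sqrtr_sqr ger0_norm.
rewrite ler_wsqrtr//; apply: ler_sum => i _.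
rewrite -real_normK ?num_real// ler_pXn2r ?nnegrE//.
rewrite /Num.norm/= mx_normrE.
exact: (le_bigmax _ (fun ij : 'I_1 * 'I_n => `|x ij.1 ij.2|) (ord0, i)).
Qed.

Lemma enorm_cvg {T : Type} {F : set_system T} {FF : Filter F}
    (u : T -> 'rV[R]_n) y :
  u s @[s --> F] --> y -> enorm (u s) @[s --> F] --> enorm y.
Proof.
move=> /cvgrPdist_lt uy; apply/cvgrPdist_lt => e e0.
have c0 : 0 < Num.sqrt n%:R + 1 :> R by rewrite ltr_wpDl// sqrtr_ge0.
near=> s; apply: le_lt_trans (ler_dist_enorm _ _) _.
apply: le_lt_trans (enorm_le_norm _) _.
have ys : `|y - u s| < e / (Num.sqrt n%:R + 1).
  by near: s; apply: uy; rewrite divr_gt0.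
move: ys; rewrite ltr_pdivlMr// mulrC; apply: le_lt_trans.
by rewrite ler_wpM2r// lerDl.
Unshelve. all: by end_near. Qed.

End EuclideanNorm.

Section ClassKoo.
Context {R : realType}.
Variables (alpha : R -> R).
Hypothesis Kalpha : class_Koo alpha.

Lemma class_Koo_lt s t : 0 <= s -> 0 <= t -> (alpha s < alpha t) = (s < t).
Proof.
case: Kalpha => _ incr _ _ s0 t0.
have H u v : 0 <= u -> 0 <= v -> u < v -> alpha u < alpha v.
  by move=> u0 v0; apply: incr; rewrite in_itv/= andbT.
apply/idP/idP; last exact: H.
case: (ltP s t) => //; rewrite le_eqVlt => /predU1P[->|/(H t s t0 s0) ts].
  by rewrite ltxx.
by rewrite (lt_gtF ts).
Qed.

Lemma class_Koo_le s t : 0 <= s -> 0 <= t -> (alpha s <= alpha t) = (s <= t).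
Proof. by move=> s0 t0; rewrite !leNgt class_Koo_lt. Qed.

(** The intermediate value theorem on a long enough interval provides a preimage of [c], and strict
    monotonicity forces the partial inverse to select it. *)
Lemma class_Koo_inv_spec c : 0 <= c ->
  0 <= Koo_inv alpha c /\ alpha (Koo_inv alpha c) = c.
Proof.
move=> c0; case: (Kalpha) => ctn _ alpha0 /cvgryPgt/(_ c) large.
have [M [Mreal Mlarge]] := large.
pose b := Num.max 0 (M + 1).
have b0 : 0 <= b by rewrite le_max lexx.
have cb : c < alpha b by apply: Mlarge; rewrite lt_max ltrDl ltr01 orbT.
have [||s] := @IVT _ alpha 0 b c b0.
- by apply: continuous_subspaceW ctn => s /=; rewrite !in_itv/= => /andP[->].
- by rewrite alpha0 ge_min c0/= le_max (ltW cb) orbT.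
rewrite in_itv/= => /andP[s0 _] sc.
have inj : {in `[0, +oo[%classic &, injective alpha}.
  move=> u v; rewrite !inE/= !in_itv/= !andbT => u0 v0 uv.
  by apply/eqP; rewrite eq_le -(class_Koo_le u v)// -(class_Koo_le v u)// uv lexx.
have -> : Koo_inv alpha c = s.
  by rewrite -sc /Koo_inv pinvKV// inE/= in_itv/= s0.
by [].
Qed.

Lemma class_Koo_gt0 s : 0 < s -> 0 < alpha s.
Proof.
move=> s0; have [_ _ alpha0 _] := Kalpha.
by rewrite -alpha0 class_Koo_lt// ltW.
Qed.

Lemma Koo_inv_gt0 c : 0 < c -> 0 < Koo_inv alpha c.
Proof.
move=> c0; have [Kc0 Kc] := class_Koo_inv_spec _ (ltW c0).
rewrite lt_neqAle Kc0 andbT; apply/eqP => K0.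
by move: c0; rewrite -Kc -K0; have [_ _ -> _] := Kalpha; rewrite ltxx.
Qed.

End ClassKoo.

(** * Dini derivatives *)

Section DiniComparison.
Context {R : realType}.
Implicit Types (s t u : R) (P : R -> Prop).

Lemma near_at_rightP P t : (\forall t' \near t^'+, P t') <->
  exists2 d, 0 < d & forall t', t < t' < t + d -> P t'.
Proof.
split=> [[d /= d0 Pd]|[d d0 Pd]].
  exists d => // t' /andP[tt' t't]; apply: Pd => //=.
  by rewrite ltr_distlC; apply/andP; split; lra.
by near=> t'; apply: Pd; apply/andP; split; near: t';
  [exact: nbhs_right_gt|apply: nbhs_right_lt; rewrite ltrDl].
Unshelve. all: by end_near. Qed.

Lemma near_at_leftP P t : (\forall t' \near t^'-, P t') <->
  exists2 d, 0 < d & forall t', t - d < t' < t -> P t'.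
Proof.
split=> [[d /= d0 Pd]|[d d0 Pd]].
  exists d => // t' /andP[tt' t't]; apply: Pd => //=.
  by rewrite ltr_distlC; apply/andP; split; lra.
by near=> t'; apply: Pd; apply/andP; split; near: t';
  [apply: nbhs_left_gt; rewrite ltrBlDr ltrDl|exact: nbhs_left_lt].
Unshelve. all: by end_near. Qed.

Lemma near_at_right_shift P t :
  (\forall h \near 0^'+, P h) -> \forall t' \near t^'+, P (t' - t).
Proof.
move=> /near_at_rightP[d d0 Pd]; apply/near_at_rightP; exists d => // t' ht'.
by apply: Pd; lra.
Qed.

(** Continuous induction: at the infimum of the counterexamples, [P] holds by the first hypothesis
    and extends to the right by the second, a contradiction. The base case [t = s] is the first
    hypothesis with a vacuous premise. *)
Lemma real_induction P s u :
  (forall t, s <= t <= u -> (forall t', s <= t' < t -> P t') -> P t) ->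
  (forall t, s <= t < u -> P t -> \forall t' \near t^'+, P t') ->
  forall t, s <= t <= u -> P t.
Proof.
move=> Pclosed Pright t0 st0u; apply: contrapT => NPt0.
pose B := [set t | s <= t <= u /\ ~ P t].
have hB : has_inf B.
  by split; [exists t0|exists s => t [/andP[]]].
have sB t : B t -> inf B <= t by move=> Bt; apply: ge_inf => //; case: hB.
have sinf : s <= inf B by apply: lb_le_inf; [case: hB|move=> t [/andP[]]].
have infu : inf B <= t0 by exact: sB.
have Pinf : P (inf B).
  apply: Pclosed => [|t' /andP[st' t'inf]]; first by lra.
  apply: contrapT => NPt'; have := @sB t'; rewrite leNgt t'inf.
  by case/(_ _)/negP => //; split => //; lra.
have inft0 : inf B < t0.
  by rewrite lt_neqAle infu andbT; apply/eqP => e; apply: NPt0; rewrite -e.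
have infu' : s <= inf B < u by lra.
have /near_at_rightP[d d0 Pd] := Pright _ infu' Pinf.
have [e Be elt] := inf_adherent d0 hB; have [_ NPe] := Be.
case: (ltP (inf B) e) => [infe|]; first by apply/NPe/Pd; rewrite infe.
rewrite le_eqVlt => /predU1P[ee|]; first by apply: NPe; rewrite ee.
by rewrite ltNge sB.
Qed.

(** A Gronwall inequality for right difference quotients. At [s], which may be an impulse time, only
    right continuity is asked; the margin [e] in [m e s = phi s + e] covers the first instants. *)
Lemma dini_comparison (phi : R -> R) (mu s u : R) : s <= u -> 0 <= mu ->
  (forall t, s <= t <= u -> 0 <= phi t) ->
  phi t @[t --> s^'+] --> phi s ->
  (forall t, s < t <= u -> phi t' @[t' --> t] --> phi t) ->
  (forall t e, s < t < u -> 0 < e ->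
    \forall t' \near t^'+, phi t' <= phi t + (t' - t) * (mu * phi t + e)) ->
  phi u <= phi s * expR (mu * (u - s)).
Proof.
move=> su mu0 phi0 phis phic phiD.
(* The comparison function m e satisfies m e (t + h) >= m e t (1 + (mu + e) h) by
   1 + z <= e^z, so phi <= m e propagates to the right of any t > s. *)
pose m e t := (phi s + e) * expR ((mu + e) * (t - s)).
have ctn_m : forall e t, m e t' @[t' --> t] --> m e t.
  move=> e t; apply: cvgM; first exact: cvg_cst.
  apply: continuous_comp; last exact: continuous_expR.
  by apply: cvgM; [exact: cvg_cst|apply: cvgB; [exact: cvg_id|exact: cvg_cst]].
have s0 : 0 <= phi s by apply: phi0; rewrite lexx.
have phim e : 0 < e -> phi u <= m e u.
  move=> e0; apply: (@real_induction (fun t => phi t <= m e t) s u); last first.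
  - by rewrite su lexx.
  - move=> t /andP[st tu] phit; case: (eqVneq s t) => [<-|neq_st].
      near=> t'.
        have st' : s < t' by near: t'; exact: nbhs_right_gt.
        apply: (@le_trans _ _ (phi s + e)).
          by near: t'; apply: (cvgr_le _ phis); rewrite ltrDl.
        rewrite ler_peMr//; first by lra.
        by rewrite -expR0 ler_expR mulr_ge0//; lra.
    have lt_st : s < t by rewrite lt_neqAle neq_st.
    have m0 : 0 < m e t by rewrite mulr_gt0 ?expR_gt0//; lra.
    near=> t'.
      have tt' : t < t' by near: t'; exact: nbhs_right_gt.
      apply: (@le_trans _ _ (phi t + (t' - t) * (mu * phi t + e * m e t))).
        near: t'; apply: phiD; first by rewrite lt_st.
        by rewrite mulr_gt0.
      have -> : m e t' = m e t * expR ((mu + e) * (t' - t)).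
        by rewrite /m -mulrA -expRD; congr (_ * expR _); ring.
      apply: (@le_trans _ _ (m e t * (1 + (mu + e) * (t' - t)))); last first.
        by rewrite ler_pM2l// expR_ge1Dx.
      have : (t' - t) * (mu * phi t) <= (t' - t) * (mu * m e t).
        by rewrite ler_pM2l ?subr_gt0// ler_wpM2l.
      by move: phit; lra.
  - move=> t /andP[st tu] phit; case: (eqVneq s t) => [<-|neq_st].
      by rewrite /m subrr mulr0 expR0 mulr1 lerDl ltW.
    have lt_st : s < t by rewrite lt_neqAle neq_st.
    apply: (@ler_cvg_to _ t^'- _ _ phi (m e)).
    + by apply: cvg_at_left_filter; apply: phic; rewrite lt_st.
    + by apply: (@cvg_at_left_filter _ _ (m e)); exact: ctn_m.
    + near=> t'; apply: phit; apply/andP; split.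
        by apply: ltW; near: t'; exact: nbhs_left_gt.
      by near: t'; exact: nbhs_left_lt.
(* The bound by [m e u] holds for every [e > 0]; let [e] tend to 0. *)
have -> : phi s * expR (mu * (u - s)) = m 0 u by rewrite /m !addr0.
apply: (@ler_cvg_to _ (0 : R)^'+ _ _ (fun=> phi u) (fun e => m e u)).
- exact: cvg_cst.
- apply: (@cvg_at_right_filter _ _ (fun e => m e u) 0); apply: cvgM.
    by apply: cvgD; [exact: cvg_cst|exact: cvg_id].
  apply: continuous_comp; last exact: continuous_expR.
  by apply: cvgM; [apply: cvgD; [exact: cvg_cst|exact: cvg_id]|exact: cvg_cst].
- by near=> e; apply: phim; near: e; exact: nbhs_right_gt.
Unshelve. all: by end_near. Qed.

End DiniComparison.

(** * First-order estimates along differentiable paths *)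

Section Paths.
Context {R : realType} {n : nat}.
Implicit Types (x : R -> 'rV[R]_n).

Lemma is_derive_right x (t : R) (v : 'rV[R]_n) (e : R) :
  is_derive t 1 x v -> 0 < e ->
  \forall t' \near t^'+, `|x t' - (x t + (t' - t) *: v)| <= e * (t' - t).
Proof.
move=> [dx dv] e0.
have /cvgrPdist_le/(_ _ e0)[r /= r0 dr] :
    h^-1 *: (x (h *: 1 + t) - x t) @[h --> 0^'] --> v by rewrite -dv; exact: dx.
apply/near_at_rightP; exists r => // t' /andP[tt' t'r].
have h0 : 0 < t' - t by rewrite subr_gt0.
have {dr} : `|v - (t' - t)^-1 *: (x t' - x t)| <= e.
  have := dr (t' - t); rewrite /= sub0r normrN gtr0_norm//.
  have -> : (t' - t) *: 1 + t = t' by rewrite /GRing.scale/= mulr1 subrK.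
  by apply; [rewrite ltrBlDl|rewrite lt0r_neq0].
move: h0; set h := t' - t => h0; rewrite distrC.
have -> : x t' - (x t + h *: v) = h *: (h^-1 *: (x t' - x t) - v).
  by rewrite scalerBr scalerA divff ?lt0r_neq0// scale1r opprD addrA.
by rewrite normrZ gtr0_norm// mulrC ler_pM2r.
Qed.

Lemma is_derive_continuous x (t : R) (v : 'rV[R]_n) :
  is_derive t 1 x v -> x s @[s --> t] --> x t.
Proof.
by move=> dx; apply: differentiable_continuous; apply/derivable1_diffP.
Qed.

Lemma is_derive_translate x (t v : R) (df : 'rV[R]_n) :
  is_derive (t + v) 1 x df -> is_derive v 1 (fun u => x (t + u)) df.
Proof.
have E :
    (fun h => h^-1 *: (((fun u => x (t + u)) \o shift v) (h *: 1) - x (t + v)))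
  = (fun h => h^-1 *: ((x \o shift (t + v)) (h *: 1) - x (t + v))).
  by apply/funext => h /=; rewrite addrCA.
by move=> [dx dxE]; split; [rewrite /derivable E|rewrite /derive E].
Qed.

Lemma class_V_cvg {T : Type} {F : set_system T} {FF : Filter F}
    (V : 'rV[R]_n -> R) (w : T -> 'rV[R]_n) y :
  class_V V -> w s @[s --> F] --> y -> V (w s) @[s --> F] --> V y.
Proof.
move=> [_ Vlip] wy; have [U Uy [K [_ /(_ _)lipV]]] := Vlip y.
(* The Lipschitz bound holds for all constants above [K]; this one is moreover positive. *)
pose k := Num.max 1 (K + 1).
have k0 : 0 < k by rewrite lt_max ltr01.
have Kk : K < k by rewrite lt_max ltrDl ltr01 orbT.
apply/cvgrPdist_lt => e e0; near=> s.
apply: (@le_lt_trans _ _ (k * `|y - w s|)).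
  apply: (lipV _ Kk (y, w s)); split => /=; first exact: nbhs_singleton.
  by near: s; exact: wy.
rewrite mulrC -ltr_pdivlMr//; near: s.
by move/cvgrPdist_lt : wy; apply; rewrite divr_gt0.
Unshelve. all: by end_near. Qed.

(** The Dini derivative looks along the straight line x(t) + h f(x(t)), which differs from the path
    by o(h). As [V] is locally Lipschitz, this costs o(h) in [V]; half of [e] pays for it and the
    other half for the limsup. *)
Lemma dini_along_path (f : 'rV[R]_n -> 'rV[R]_n) (V : 'rV[R]_n -> R) x
    (t c e : R) :
  class_V V -> (dini f V (x t) <= c%:E)%E -> is_derive t 1 x (f (x t)) ->
  0 < e ->
  \forall t' \near t^'+, V (x t') <= V (x t) + (t' - t) * (c + e).
Proof.
move=> [_ Vlip] dV dx e0; have [U Ux [K [_ /(_ _)lipV]]] := Vlip (x t).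
pose k := Num.max 1 (K + 1).
have k0 : 0 < k by rewrite lt_max ltr01.
have Kk : K < k by rewrite lt_max ltrDl ltr01 orbT.
have e20 : 0 < e / 2 by rewrite divr_gt0.
have : (dini f V (x t) < (c + e / 2)%:E)%E.
  by apply: le_lt_trans dV _; rewrite lte_fin ltrDl.
move=> /ereal_inf_lt[_ [A nA <-] supA].
have nA' := near_at_right_shift _ t nA.
near=> t'.
have tt' : t < t' by near: t'; exact: nbhs_right_gt.
have h0 : 0 < t' - t by rewrite subr_gt0.
have Vdini : V (x t + (t' - t) *: f (x t)) - V (x t) <= (c + e / 2) * (t' - t).
  rewrite -ler_pdivrMr// -lee_fin; apply: le_trans (ltW supA).
  by apply: ereal_sup_ubound; exists (t' - t) => //; near: t'.
have : `|V (x t') - V (x t + (t' - t) *: f (x t))| <=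
    k * `|x t' - (x t + (t' - t) *: f (x t))|.
  apply: (lipV _ Kk (x t', x t + (t' - t) *: f (x t))); split => /=; near: t'.
    exact: (cvg_at_right_filter (is_derive_continuous _ _ _ dx)).
  have : x t + (s - t) *: f (x t) @[s --> t^'+] --> x t.
    rewrite -[X in _ --> X]addr0; apply: cvgD; first exact: cvg_cst.
    rewrite -[X in _ --> X](scale0r (f (x t))); apply: cvgZr_tmp.
    rewrite -(subrr t); apply: cvgB; last exact: cvg_cst.
    exact: cvg_at_right_filter.
  exact.
have : `|x t' - (x t + (t' - t) *: f (x t))| <= e / 2 / k * (t' - t).
  by near: t'; apply: is_derive_right => //; rewrite divr_gt0.
rewrite -(ler_pM2l k0) => H1 H2; move: (le_trans H2 H1).
rewrite mulrA (mulrCA k) divff ?lt0r_neq0// mulr1 => /ler_normlW.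
by move: Vdini; lra.
Unshelve. all: by end_near. Qed.

(** Triangle inequality on the first-order expansion at [t]; [k] converts the sup norm of the
    remainder into its Euclidean norm. *)
Lemma enorm_along_path x (y v : 'rV[R]_n) (t e : R) :
  is_derive t 1 x v -> 0 < e ->
  \forall t' \near t^'+,
    enorm (x t' - y) <= enorm (x t - y) + (t' - t) * (enorm v + e).
Proof.
move=> dx e0; pose k := Num.sqrt n%:R + 1 : R.
have k0 : 0 < k by rewrite ltr_wpDl// sqrtr_ge0.
near=> t'.
have tt' : t < t' by near: t'; exact: nbhs_right_gt.
have -> : x t' - y = (x t - y) + (t' - t) *: v + (x t' - (x t + (t' - t) *: v)).
  by apply/rowP => i; rewrite !mxE; ring.
apply: le_trans (enormD _ _) _.
have := enormD (x t - y) ((t' - t) *: v).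
rewrite enormZ gtr0_norm ?subr_gt0// => H1.
have H2 := enorm_le_norm (x t' - (x t + (t' - t) *: v)).
have : `|x t' - (x t + (t' - t) *: v)| <= e / k * (t' - t).
  by near: t'; apply: is_derive_right => //; rewrite divr_gt0.
rewrite -(ler_pM2l k0) mulrA (mulrCA k) divff ?lt0r_neq0// mulr1 => H3.
have H4 : Num.sqrt n%:R * `|x t' - (x t + (t' - t) *: v)| <=
    k * `|x t' - (x t + (t' - t) *: v)| by rewrite ler_wpM2r// lerDl.
by lra.
Unshelve. all: by end_near. Qed.

End Paths.

(** * Flow inside the ball *)

Section Flow.
Context {R : realType} {n : nat}.
Variables (f : 'rV[R]_n -> 'rV[R]_n) (V : 'rV[R]_n -> R) (alpha1 : R -> R).
Variables (L1 mu r : R).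
Hypotheses (classV : class_V V) (Kalpha1 : class_Koo alpha1).
Hypotheses (L1_ge0 : 0 <= L1) (mu_ge0 : 0 <= mu).
Hypothesis f_le : forall y, eball r y -> enorm (f y) <= L1 * enorm y.
Hypothesis V_ge : forall y, eball r y -> alpha1 (enorm y) <= V y.
Hypothesis V_dini : forall y, eball r y -> (dini f V y <= (mu * V y)%:E)%E.

(** The left endpoint only carries right continuity, because a flow phase may begin with a jump. *)
Definition flow_on (s u : R) (x : R -> 'rV[R]_n) :=
  x t @[t --> s^'+] --> x s /\
  forall t, s < t <= u -> is_derive t 1 x (f (x t)).

Lemma flow_on_le s u u' x : u' <= u -> flow_on s u x -> flow_on s u' x.
Proof.
move=> u'u [xs dx]; split => // t /andP[st tu']; apply: dx.
by rewrite st (le_trans tu').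
Qed.

Lemma growth s u x : s <= u -> flow_on s u x ->
  (forall t, s <= t <= u -> eball r (x t)) ->
  V (x u) <= V (x s) * expR (mu * (u - s)).
Proof.
move=> su [xs dx] xr; have [V_ge0 _] := classV.
apply: (@dini_comparison _ (V \o x)) => //=.
- exact: class_V_cvg.
- by move=> t st; apply: class_V_cvg => //; exact/is_derive_continuous/dx.
- move=> t e /andP[st tu] e0; apply: (@dini_along_path _ _ f V) => //.
    by apply: V_dini; apply: xr; rewrite !ltW.
  by apply: dx; rewrite st ltW.
Qed.

(** The function [phi t] = |x(t) - x(s)| + |x(s)| dominates |x(t)|, so it grows at rate at most [L1]
    times itself, and it starts at |x(s)|. *)
Lemma displacement s u x : s <= u -> flow_on s u x ->
  (forall t, s <= t <= u -> eball r (x t)) ->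
  enorm (x u - x s) <= enorm (x s) * (expR (L1 * (u - s)) - 1).
Proof.
move=> su [xs dx] xr.
rewrite mulrBr mulr1 lerBrDr.
pose phi t := enorm (x t - x s) + enorm (x s).
have phis : phi s = enorm (x s) by rewrite /phi subrr enorm0 add0r.
have cvg_phi (F : set_system R) (FF : Filter F) (y : 'rV[R]_n) :
    x t @[t --> F] --> y ->
    phi t @[t --> F] --> enorm (y - x s) + enorm (x s).
  move=> xy; apply: cvgD; last exact: cvg_cst.
  by apply: enorm_cvg; apply: cvgB; [exact: xy|exact: cvg_cst].
rewrite -[X in _ <= X * _]phis; apply: (@dini_comparison _ phi) => //.
- by move=> t _; rewrite addr_ge0 ?enorm_ge0.
- exact: cvg_phi.
- by move=> t st; apply: cvg_phi; exact/is_derive_continuous/dx.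
- move=> t e /andP[st tu] e0.
  have : is_derive t 1 x (f (x t)) by apply: dx; rewrite st ltW.
  move=> /enorm_along_path - /(_ (x s) _ e0); apply: filterS2 (nbhs_right_gt t).
  move=> t' tt'.
  have : enorm (f (x t)) <= L1 * phi t.
    apply: le_trans (f_le _ _) _; first by apply: xr; rewrite !ltW.
    by rewrite ler_wpM2l// enormBD.
  rewrite -(@ler_pM2l _ (t' - t)) ?subr_gt0//.
  by rewrite /phi; lra.
Qed.

Lemma sublevel_radius c : 0 <= c < alpha1 r -> 0 <= r -> Koo_inv alpha1 c < r.
Proof.
move=> /andP[c0 cr] r0; have [Kc0 Kc] := class_Koo_inv_spec _ Kalpha1 _ c0.
by rewrite -(class_Koo_lt _ Kalpha1)// Kc.
Qed.

Lemma sublevel_enorm c y : eball r y -> V y <= c -> enorm y <= Koo_inv alpha1 c.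
Proof.
move=> yr Vyc; have [V_ge0 _] := classV.
have [Kc0 Kc] := class_Koo_inv_spec _ Kalpha1 _ (le_trans (V_ge0 y) Vyc).
by rewrite -(class_Koo_le _ Kalpha1) ?enorm_ge0// Kc (le_trans (V_ge _ yr)).
Qed.

(** The open ball is not closed under limits, but its points with [V <= c] have norm at most
    [Koo_inv alpha1 c], which is less than [r], and this bound passes to the limit. *)
Lemma sublevel_closed {T : topologicalType} {F : set_system T} {FF : ProperFilter F}
    (w : T -> 'rV[R]_n) y c : w s @[s --> F] --> y -> c < alpha1 r ->
  (\forall s \near F, eball r (w s) /\ V (w s) <= c) -> eball r y /\ V y <= c.
Proof.
move=> wy cr near_w.
have [s [ws Vws]] := filter_ex near_w.
have [V_ge0 _] := classV.
have r0 : 0 <= r by exact: (le_trans (enorm_ge0 (w s)) (ltW ws)).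
have c0 : 0 <= c := le_trans (V_ge0 _) Vws.
split.
  apply: le_lt_trans (sublevel_radius c _ r0); last by rewrite c0.
  apply: (ler_cvg_to (enorm_cvg _ _ wy) (cvg_cst _)).
  by apply: filterS near_w => t [wt Vwt]; exact: sublevel_enorm.
apply: (ler_cvg_to (class_V_cvg V _ _ classV wy) (cvg_cst _)).
by apply: filterS near_w => t [].
Qed.

(** The bound on [V] at [t] may presuppose that the path has stayed in the ball up to [t];
    continuous induction resolves the circularity. The ball is open, which gives the step to the
    right, and [sublevel_closed] gives the limit step. *)
Lemma barrier s u x c : s <= u -> flow_on s u x -> eball r (x s) ->
  c < alpha1 r ->
  (forall t, s <= t <= u -> (forall t', s <= t' <= t -> eball r (x t')) ->
    V (x t) <= c) ->
  forall t, s <= t <= u -> eball r (x t).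
Proof.
move=> su [xs dx] xsr cr Vc; apply: real_induction => t /andP[st tu] xr.
  case: (eqVneq s t) => [<-//|neq_st].
  have lt_st : s < t by rewrite lt_neqAle neq_st.
  have xt : x t' @[t' --> t^'-] --> x t.
    apply: cvg_at_left_filter; apply: is_derive_continuous; apply: dx.
    by rewrite lt_st.
  suff [] : eball r (x t) /\ V (x t) <= c by [].
  apply: (sublevel_closed x (x t) c xt cr); near=> t'.
  have st' : s < t' by near: t'; exact: nbhs_left_gt.
  have t't : t' < t by near: t'; exact: nbhs_left_lt.
  split; first by apply: xr; rewrite ltW.
  apply: Vc => [|t'' /andP[st'' t''t']]; first by lra.
  by apply: xr; lra.
have : x t' @[t' --> t^'+] --> x t.
  case: (eqVneq s t) => [<-//|neq_st].
  apply: cvg_at_right_filter; apply: is_derive_continuous; apply: dx.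
  by rewrite lt_neqAle neq_st st ltW.
by move=> /enorm_cvg/cvgr_lt; apply.
Unshelve. all: by end_near. Qed.

(** The barrier level is the growth bound at the final time [u], the largest one on the interval. *)
Lemma flow_in_ball s u x : s <= u -> flow_on s u x -> eball r (x s) ->
  V (x s) * expR (mu * (u - s)) < alpha1 r ->
  forall t, s <= t <= u ->
    eball r (x t) /\ V (x t) <= V (x s) * expR (mu * (t - s)).
Proof.
move=> su flx xsr Vxs; have [V_ge0 _] := classV.
have grow t : s <= t <= u -> (forall t', s <= t' <= t -> eball r (x t')) ->
    V (x t) <= V (x s) * expR (mu * (t - s)).
  by move=> /andP[st tu] xr; apply: growth => //; exact: flow_on_le flx.
have inball : forall t, s <= t <= u -> eball r (x t).
  apply: (@barrier s u x _ su flx xsr Vxs) => t stu xr.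
  apply: (le_trans (grow _ stu xr)).
  by rewrite ler_wpM2l// ler_expR ler_wpM2l//; lra.
move=> t stu; split; first exact: inball.
by apply: grow => // t' st't; apply: inball; lra.
Qed.

End Flow.

(** After squaring and factoring e^(2u) - 1 = (e^u - 1)(e^u + 1), it suffices that 2 (e^u - 1) <= u
    (e^u + 1). The difference [h] of the two sides vanishes at 0 and has derivative 1 + (v - 1) e^v,
    nonnegative because e^(-v) >= 1 - v. *)
Lemma expR_sub1_le_sqrt {R : realType} (u : R) : 0 <= u ->
  expR u - 1 <= Num.sqrt (u * (expR (2 * u) - 1) / 2).
Proof.
move=> u0.
have key : 2 * (expR u - 1) <= u * (expR u + 1).
  move: u0; rewrite le_eqVlt => /predU1P[<-|u0].
    by rewrite expR0 subrr mulr0 mul0r.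
  pose h : R -> R := fun v => v * (expR v + 1) - 2 * (expR v - 1).
  have dh (v : R) : is_derive v 1 h (1 + (v - 1) * expR v).
    have -> : h = (id * (expR + cst 1)) - (2 \*: (expR - cst 1)).
      by apply/funext => w; rewrite /h /=.
    apply: is_derive_eq; rewrite /GRing.scale/= !fctE/=; ring.
  have [|v] := @MVT _ h _ 0 u u0 (fun v _ => dh v).
    apply: continuous_subspaceT => v.
    exact/differentiable_continuous/derivable1_diffP.
  rewrite in_itv/= => /andP[v0 vu].
  have e0 := expR_gt0 v; have : (1 - v) * expR v <= 1.
    rewrite -ler_pdivlMr// div1r -expRN; have := expR_ge1Dx (- v); lra.
  rewrite {1 2}/h expR0 => H1 H2.
  have : 0 <= (1 + (v - 1) * expR v) * (u - 0) by rewrite mulr_ge0//; lra.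
  rewrite -H2; lra.
have e1 : 0 <= expR u - 1 by rewrite subr_ge0 -expR0 ler_expR.
rewrite -[leLHS]ger0_norm// -sqrtr_sqr ler_wsqrtr//.
rewrite mulr_natl mulr2n expRD.
have := ler_wpM2l e1 key; nra.
Qed.

(** * Event times *)

Section EventTimes.
Context {R : realType} {n : nat}.
Variables (f g : 'rV[R]_n -> 'rV[R]_n) (V : 'rV[R]_n -> R) (a b tau : R).
Variables (x0 : 'rV[R]_n) (T : \bar R) (x : R -> 'rV[R]_n).
Hypothesis tau_ge0 : 0 <= tau.
Local Notation E := (event_time V a b tau x0 T x).
Local Notation y_ := (sampled_state tau x0 x).
Local Notation impulse := (impulse_time V a b tau x0 T x).

(** Gives the first event and the later ones a common form; for positive index, these are the
    impulse times. *)
Definition search_start (k : nat) : \bar R :=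
  if k is k'.+1 then (E k' + tau%:E)%E else 0%E.
Local Notation S := search_start.

(** The post-jump state is read only at the start of a search that follows an impulse; the first
    search, with [k = 0], always reads the sampled state. *)
Definition monitored_state (k : nat) (t : R) : 'rV[R]_n :=
  if (0 < k)%N && (t%:E == S k) then x t else y_ t.

Lemma event_timeE k : E k = ereal_inf [set t%:E | t in [set t : R |
  [/\ (S k <= t%:E)%E, (t%:E < T)%E & triggers V a b (monitored_state k t) t]]].
Proof. by case: k. Qed.

Lemma search_start_le_event k : (S k <= E k)%E.
Proof. by rewrite event_timeE; apply: le_ereal_inf_tmp => _ [t [? _ _] <-]. Qed.

Lemma event_le_next_start k : (E k <= S k.+1)%E.
Proof. by rewrite leeDl// lee_fin. Qed.

Lemma search_start_mono j k : (j <= k)%N -> (S j <= S k)%E.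
Proof.
elim: k => [|k IH]; first by rewrite leqn0 => /eqP->.
rewrite leq_eqVlt => /predU1P[->//|jk]; apply: le_trans (IH jk) _.
exact: le_trans (search_start_le_event k) (event_le_next_start k).
Qed.

Lemma search_start_ge0 k : (0 <= S k)%E.
Proof. exact: (search_start_mono 0 k). Qed.

Lemma event_time_ge0 k : (0 <= E k)%E.
Proof. exact: le_trans (search_start_ge0 k) (search_start_le_event k). Qed.

Lemma event_le k t : (S k <= t%:E)%E -> (t%:E < T)%E ->
  triggers V a b (monitored_state k t) t -> (E k <= t%:E)%E.
Proof. by move=> *; rewrite event_timeE; apply: ereal_inf_lbound; exists t. Qed.

(** The infimum defining an event time is not known to be attained; triggering times arbitrarily
    close to it serve instead. *)
Lemma event_adherent k u : (E k < u)%E -> exists t,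
  [/\ (S k <= t%:E)%E, (t%:E < T)%E, (t%:E < u)%E, (E k <= t%:E)%E &
      triggers V a b (monitored_state k t) t].
Proof.
rewrite {1}event_timeE => /ereal_inf_lt[_ [t [St tT trig] <-] tu].
by exists t; split => //; exact: event_le.
Qed.

Lemma event_finite k : (E k < +oo)%E ->
  exists t, [/\ E k = t%:E, 0 <= t & (t%:E < T)%E].
Proof.
move=> Ek; have [t [_ tT _ Et _]] := event_adherent _ _ Ek.
have := event_time_ge0 k; move: Ek Et; case: (E k) => // e _ Et e0.
by exists e; split => //; exact: le_lt_trans Et tT.
Qed.

Lemma event_bounds k t : E k = t%:E -> 0 <= t /\ (t%:E < T)%E.
Proof.
move=> Ekt; have [|t' []] := event_finite k; first by rewrite Ekt ltry.
by rewrite Ekt => -[<-].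
Qed.

Lemma search_start_finite k t : E k = t%:E -> exists2 s, S k = s%:E & 0 <= s <= t.
Proof.
move=> Ekt; have := search_start_le_event k; have := search_start_ge0 k.
rewrite Ekt; case: (S k) => // s; rewrite !lee_fin => s0 st.
by exists s => //; rewrite s0.
Qed.

(** Every impulse time is some [S j.+1], and [S] is nondecreasing. *)
Lemma no_impulse k t : (S k < t%:E)%E -> (t%:E < S k.+1)%E -> ~ impulse t.
Proof.
move=> Skt tSk [j Ejt]; have Sjt : S j.+1 = t%:E := Ejt.
case: (leqP j.+1 k) => [|kj]; first by
  move=> /search_start_mono; rewrite Sjt leNgt Skt.
by have := search_start_mono _ _ kj; rewrite Sjt leNgt tSk.
Qed.

Hypothesis solx : solution f g V a b tau x0 T x.

Lemma is_derive_between k t : (S k < t%:E)%E -> (t%:E < S k.+1)%E ->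
  (t%:E < T)%E -> is_derive t 1 x (f (x t)).
Proof.
move=> Skt tSk tT; case: solx => _ _ dx _ _; apply: dx => //.
  by rewrite -lte_fin (le_lt_trans (search_start_ge0 k)).
exact: (no_impulse k).
Qed.

Lemma search_start_right_cvg k s : S k = s%:E -> (s%:E < T)%E ->
  x t @[t --> s^'+] --> x s.
Proof.
case: solx => _ _ _ rc _; case: k => [[<-]|k Sks] sT; apply: rc => //.
  by left.
have := search_start_ge0 k.+1; rewrite Sks lee_fin le_eqVlt => /predU1P[->|s0].
  by left.
by right; split => //; exists k.
Qed.

(** Shows that the [lim] in [left_state] is a genuine limit: at impulse times this is part of
    [solution], elsewhere the path is differentiable. *)
Lemma left_state_cvg t : 0 < t -> (t%:E < T)%E ->
  x s @[s --> t^'-] --> left_state x0 x t.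
Proof.
move=> t0 tT; rewrite /left_state leNgt t0/=; case: solx => _ _ dx _ jump.
have [[k Ekt]|noimp] := pselect (impulse t).
  have : (E k < +oo)%E by case: (E k) Ekt => [e _|//|_]; rewrite ?ltry.
  move=> /event_finite[e [Eke e0 eT]].
  have te : t = e + tau by move: Ekt; rewrite Eke => -[].
  have [] := jump k e Eke; first by rewrite -te.
  by rewrite -te => /(_ t0).
have xt : x s @[s --> t^'-] --> x t.
  exact/cvg_at_left_filter/is_derive_continuous/dx.
by apply/cvgP: xt.
Qed.

Lemma sampled_state_continuous t v : 0 < t -> (t%:E < T)%E ->
  is_derive t 1 x v -> y_ t = x t.
Proof.
move=> t0 tT dx; rewrite /sampled_state; case: eqP => // _.
apply: (@cvg_unique _ _ (x s @[s --> t^'-])) => //.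
  exact: left_state_cvg.
exact/cvg_at_left_filter/is_derive_continuous.
Qed.

(** Without delay the sampled state is the left limit by definition. With a positive delay, [t] lies
    strictly between [S k] and [S k.+1], where the path is differentiable. *)
Lemma sampled_state_left_cvg k t : 0 < t -> (S k < t%:E)%E -> E k = t%:E ->
  x s @[s --> t^'-] --> y_ t.
Proof.
move=> t0 Skt Ekt; have [_ tT] := event_bounds _ _ Ekt.
rewrite /sampled_state; case: eqP => [_|tau0]; first exact: left_state_cvg.
apply/cvg_at_left_filter/is_derive_continuous/(is_derive_between k) => //.
by rewrite /S Ekt -EFinD lte_fin ltrDl lt_neqAle eq_sym tau_ge0 andbT; exact/eqP.
Qed.

Lemma no_trigger_right t : class_V V -> 0 <= t -> 0 < b -> 0 < a ->
  x s @[s --> t^'+] --> x t -> V (x t) < a * expR (- b * t) ->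
  exists2 d, 0 < d & forall s, t < s < t + d -> (s%:E < T)%E ->
    V (y_ s) < a * expR (- b * s).
Proof.
move=> classV t0 b0 a0 xt Vt; pose w s := a * expR (- b * s).
(* A fixed level strictly between [V] and the threshold: when the sampled state is a left limit,
   only the weak bound [V <= c] survives, and it must still imply [V < w s]. *)
pose c := (V (x t) + w t) / 2.
have Vc : V (x t) < c by rewrite /c /w; lra.
have cw : c < w t by rewrite /c /w; lra.
have cvgV : V (x s) @[s --> t^'+] --> V (x t) by exact: class_V_cvg.
have cvgw : w s @[s --> t^'+] --> w t.
  apply: cvg_at_right_filter; apply: cvgM; first exact: cvg_cst.
  apply: continuous_comp; last exact: continuous_expR.
  by apply: cvgM; [exact: cvg_cst|exact: cvg_id].
have : \forall s \near t^'+, V (x s) < c /\ c < w s.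
  near=> s; split; near: s; first exact: (cvgr_lt _ cvgV).
  exact: (cvgr_gt _ cvgw).
move=> /near_at_rightP[d d0 Hd]; exists d => // s /andP[ts sd] sT.
have [Vs ws] : V (x s) < c /\ c < w s by apply: Hd; rewrite ts.
rewrite /sampled_state; case: ifP => _; last exact: lt_trans ws.
apply: le_lt_trans ws.
have s0 : 0 < s by exact: le_lt_trans ts.
have xs := left_state_cvg _ s0 sT.
apply: (ler_cvg_to (class_V_cvg V _ _ classV xs) (cvg_cst c)).
near=> u; apply: ltW; have [|//] := Hd u.
have tu : t < u by near: u; exact: nbhs_left_gt.
have us : u < s by near: u; exact: nbhs_left_lt.
by lra.
Unshelve. all: by end_near. Qed.

End EventTimes.

Arguments event_bounds {R n V a b tau x0 T x} tau_ge0 {k t}.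
Arguments search_start_finite {R n V a b tau x0 T x} tau_ge0 {k t}.

(** * Closed-loop trajectories *)

(** The delay plus the time that [V], reset to rho a e^(-bt) at time t + tau and growing at rate
    [mu], needs to meet the decreasing threshold. *)
Definition dwell_time {R : realType} (mu rho b tau : R) :=
  tau - ln (rho * expR (b * tau)) / (b + mu).

Lemma dwell_time_gt {R : realType} (mu rho b tau : R) : 0 < b -> 0 < mu ->
  0 < rho -> rho * expR (b * tau) < 1 -> tau < dwell_time mu rho b tau.
Proof.
move=> b0 mu0 rho0 rho_b_tau; rewrite /dwell_time ltrDl oppr_gt0 pmulr_llt0.
  by apply: ln_lt0; rewrite mulr_gt0 ?expR_gt0.
by rewrite invr_gt0 addr_gt0.
Qed.

Section ClosedLoop.
Context {R : realType} {n : nat}.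
Variables (f g : 'rV[R]_n -> 'rV[R]_n) (V : 'rV[R]_n -> R).
Variables (alpha1 alpha2 : R -> R).
Variables (L1 L2 mu rho a b tau r : R).
Hypotheses (a_gt0 : 0 < a) (b_gt0 : 0 < b) (r_gt0 : 0 < r).
Hypothesis growth_fg : assumptionA f g L1 L2 r.
Hypothesis lyapunov : assumptionB f g tau V alpha1 alpha2 mu rho r.
Hypothesis a_lt : a < alpha1 r.
Hypothesis tau_ge0 : 0 <= tau.
Hypothesis a_mu_tau : a * expR (mu * tau) < alpha1 r.
Hypothesis rho_b_tau : rho * expR (b * tau) < 1.
Hypothesis jump_small :
  (L2 + (expR (L1 * tau) - 1)) * Koo_inv alpha1 a < r.

Let classV : class_V V. Proof. by case: lyapunov. Qed.
Let V_ge0 y : 0 <= V y. Proof. by case: classV. Qed.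
Let Kalpha1 : class_Koo alpha1. Proof. by case: lyapunov => _ []. Qed.
Let Kalpha2 : class_Koo alpha2. Proof. by case: lyapunov => _ []. Qed.
Let mu_gt0 : 0 < mu. Proof. by case: lyapunov. Qed.
Let mu_ge0 : 0 <= mu. Proof. exact: ltW. Qed.
Let rho_gt0 : 0 < rho. Proof. by case: lyapunov. Qed.
Let rho_lt1 : rho < 1.
Proof.
apply: le_lt_trans rho_b_tau; rewrite ler_peMr ?(ltW rho_gt0)//.
by rewrite -expR0 ler_expR mulr_ge0// ltW.
Qed.
Let L1_ge0 : 0 <= L1. Proof. by case: growth_fg => /ltW. Qed.
Let f_le y : eball r y -> enorm (f y) <= L1 * enorm y.
Proof. by move=> yr; case: growth_fg => _ _ /(_ y yr)[]. Qed.
Let V_ge y : eball r y -> alpha1 (enorm y) <= V y.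
Proof. by case: lyapunov => _ _ _ _ H /H[/andP[]]. Qed.
Let V_le y : eball r y -> V y <= alpha2 (enorm y).
Proof. by case: lyapunov => _ _ _ _ H /H[/andP[]]. Qed.
Let V_dini y : eball r y -> (dini f V y <= (mu * V y)%:E)%E.
Proof. by case: lyapunov => _ _ _ _ H /H[]. Qed.

Local Notation gamma := (dwell_time mu rho b tau).

Definition threshold (t : R) := a * expR (- b * t).
Local Notation w := threshold.

Lemma threshold_le s t : s <= t -> w t <= w s.
Proof. by move=> st; rewrite ler_pM2l// ler_expR !mulNr lerN2 ler_pM2l. Qed.

Lemma threshold_le_a t : 0 <= t -> w t <= a.
Proof. by move=> /threshold_le; rewrite {2}/w mulr0 expR0 mulr1. Qed.

Lemma threshold_jump t : rho * w t < w (t + tau).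
Proof.
rewrite /threshold mulrDr expRD [ltRHS]mulrA [ltLHS]mulrC.
rewrite ltr_pM2l ?mulr_gt0 ?expR_gt0//.
by rewrite mulNr expRN -div1r ltr_pdivlMr ?expR_gt0.
Qed.

(** Splitting z(tau) + g(y) as (y + g(y)) + (z(tau) - y) bounds its norm by (L2 + e^(L1 tau) - 1)
    |y|, and |y| is at most [Koo_inv alpha1 a]. So the state lands in the ball, where clause (iii)
    of Assumption B applies. *)
Lemma jump_estimate y z : eball r y -> V y <= a -> ivp_solution f tau y z ->
  eball r (z tau) -> enorm (z tau - y) <= enorm y * (expR (L1 * tau) - 1) ->
  eball r (z tau + g y) /\ V (z tau + g y) <= rho * V y.
Proof.
move=> yr Vy ivp zr zy.
suff zgr : eball r (z tau + g y).
  by split => //; case: lyapunov => _ _ _ _ /(_ y yr)[_ _ H]; exact: H.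
apply: le_lt_trans jump_small.
have -> : z tau + g y = (y + g y) + (z tau - y).
  by apply/rowP => i; rewrite !mxE; ring.
apply: le_trans (enormD _ _) _.
case: growth_fg => L10 L20 /(_ y yr)[_ gy].
have e0 : 0 <= expR (L1 * tau) - 1 by rewrite subr_ge0 -expR0 ler_expR mulr_ge0.
apply: (@le_trans _ _ ((L2 + (expR (L1 * tau) - 1)) * enorm y)).
  by move: gy zy; lra.
have c0 : 0 <= L2 + (expR (L1 * tau) - 1) by lra.
by rewrite ler_wpM2l//; exact: (sublevel_enorm V alpha1 r).
Qed.

Lemma delay_phase x t s : t <= s <= t + tau -> flow_on f t s x ->
  eball r (x t) -> V (x t) <= a ->
  eball r (x s) /\ V (x s) <= V (x t) * expR (mu * (s - t)).
Proof.
move=> /andP[ts stau] flx xtr Vxt.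
apply: (flow_in_ball f V alpha1 mu r _ _ _ _ _ t s) => //; last first.
  by rewrite ts lexx.
apply: le_lt_trans a_mu_tau; rewrite ler_pM ?expR_ge0// ler_expR ler_wpM2l//; lra.
Qed.

Lemma flow_delay x t (ytau : 'rV[R]_n) : 0 < tau -> eball r (x t) ->
  V (x t) <= a -> x s @[s --> t^'+] --> x t ->
  (forall s, t < s < t + tau -> is_derive s 1 x (f (x s))) ->
  x s @[s --> (t + tau)^'-] --> ytau ->
  eball r (ytau + g (x t)) /\ V (ytau + g (x t)) <= rho * V (x t).
Proof.
move=> tau_gt0 xtr Vxt xt dx xtau.
have flx s : t <= s < t + tau -> flow_on f t s x.
  by move=> /andP[ts stau]; split => // u /andP[tu us]; apply: dx; lra.
have inball s : t <= s < t + tau ->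
    eball r (x s) /\ V (x s) <= V (x t) * expR (mu * (s - t)).
  by move=> tstau; apply: delay_phase => //; [lra|exact: flx].
have near_tau : \forall s \near (t + tau)^'-, t <= s < t + tau.
  near=> s; apply/andP; split; last by near: s; exact: nbhs_left_lt.
  by apply: ltW; near: s; apply: nbhs_left_gt; rewrite ltrDl.
have [ytr _] : eball r ytau /\ V ytau <= a * expR (mu * tau).
  apply: (sublevel_closed V alpha1 r _ _ _ x _ _ xtau a_mu_tau) => //.
  apply: filterS near_tau => s ts; have [xr Vxs] := inball s ts; split => //.
  apply: le_trans Vxs _; rewrite ler_pM ?expR_ge0// ler_expR ler_wpM2l//; lra.
(* The path itself jumps at [t + tau]; replacing its value there by the left limit [ytau] yields a
   solution of the initial value problem, continuous on the closed interval. *)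
pose z v := if v < tau then x (t + v) else ytau.
have ztau : z tau = ytau by rewrite /z ltxx.
rewrite -ztau; apply: jump_estimate => //; last 2 first.
- by rewrite ztau.
- have disp : enorm (x s - x t) @[s --> (t + tau)^'-] --> enorm (ytau - x t).
    by apply: enorm_cvg; apply: cvgB; [exact: xtau|exact: cvg_cst].
  rewrite ztau; apply: (ler_cvg_to disp (cvg_cst _)).
  apply: filterS near_tau => s tsu; have /andP[ts st] := tsu.
  apply: (@le_trans _ _ (enorm (x t) * (expR (L1 * (s - t)) - 1))).
    apply: (displacement f L1 r) => //; first exact: flx.
    by move=> u /andP[tu us]; have [|//] := inball u; lra.
  by rewrite ler_wpM2l ?enorm_ge0// lerD2r ler_expR ler_wpM2l//; lra.
have zshift v : v < tau -> \forall u \near v, x (t + u) = z u.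
  by move=> vtau; near=> u; rewrite /z ifT//; near: u; exact: lt_nbhsl.
have dz v : 0 < v < tau -> is_derive v 1 z (f (z v)).
  move=> /andP[v0 vtau]; apply: near_eq_is_derive (zshift _ vtau) _.
  apply: is_derive_translate; rewrite /z vtau; apply: dx; lra.
split => //; first by rewrite /z tau_gt0 addr0.
apply/continuous_within_itvP => //; split.
- move=> v; rewrite in_itv/= => /dz; exact: is_derive_continuous.
- rewrite {2}/z tau_gt0 addr0 => A /xt/near_at_rightP[d d0 Hd].
  apply/near_at_rightP; exists (Num.min d tau); first by rewrite lt_min d0.
  move=> v; rewrite add0r lt_min => /and3P[v0 vd vtau].
  suff: A (z v) by [].
  by rewrite /z vtau; apply: Hd; lra.
- rewrite ztau => A /xtau/near_at_leftP[d d0 Hd].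
  apply/near_at_leftP; exists d => // v /andP[vd vtau].
  suff: A (z v) by [].
  by rewrite /z vtau; apply: Hd; lra.
Unshelve. all: by end_near. Qed.

(** * A single trajectory started in the ball of radius [Koo_inv alpha2 a] *)

Section Trajectory.
Variables (x0 : 'rV[R]_n) (T : \bar R) (x : R -> 'rV[R]_n).
Hypothesis x0_small : enorm x0 < Koo_inv alpha2 a.
Hypothesis solx : solution f g V a b tau x0 T x.
Local Notation E := (event_time V a b tau x0 T x).
Local Notation y_ := (sampled_state tau x0 x).
Local Notation S := (search_start V a b tau x0 T x).

(* If |x0| >= r, rescale x0 to norm alpha1^-1(a) < r: there V >= a, whereas
   V <= alpha2(|x0|) < a. *)
Lemma initial_in_ball : eball r x0 /\ V x0 < a.
Proof.
have [Ka2_ge0 Ka2] := class_Koo_inv_spec _ Kalpha2 _ (ltW a_gt0).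
have [Ka1_ge0 Ka1] := class_Koo_inv_spec _ Kalpha1 _ (ltW a_gt0).
have x0_ge0 := enorm_ge0 x0.
have alpha2x0 : alpha2 (enorm x0) < a by rewrite -Ka2 class_Koo_lt.
suff x0r : eball r x0 by split => //; exact: le_lt_trans (V_le _ x0r) _.
rewrite /eball/= ltNge; apply/negP => rx0.
have Ka1r : Koo_inv alpha1 a < r.
  by apply: sublevel_radius => //; [rewrite ltW|exact: ltW].
have x0_gt0 : 0 < enorm x0 by exact: lt_le_trans rx0.
pose y := (Koo_inv alpha1 a / enorm x0) *: x0.
have yE : enorm y = Koo_inv alpha1 a.
  rewrite enormZ ger0_norm ?divr_ge0//.
  by rewrite divfK// lt0r_neq0.
have yr : eball r y by rewrite /eball/= yE.
have : a < a; last by rewrite ltxx.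
rewrite -{1}Ka1 -yE; apply: le_lt_trans (V_ge _ yr) _.
apply: le_lt_trans (V_le _ yr) _; apply: le_lt_trans alpha2x0.
by rewrite class_Koo_le ?enorm_ge0// yE ltW// (lt_le_trans Ka1r).
Qed.

(* [solution] leaves room for an impulse at time 0 when tau = 0, in which case
   x 0 = x0 + g x0. *)
Lemma initial_state : eball r (x 0) /\ V (x 0) <= V x0.
Proof.
have [x0r Vx0] := initial_in_ball.
case: solx => T0 no_impulse0 _ _ jump.
have [[k Ektau]|/no_impulse0->//] := pselect (impulse_time V a b tau x0 T x 0).
have [e] : exists t, [/\ E k = t%:E, 0 <= t & (t%:E < T)%E].
  by apply: event_finite => //; case: (E k) Ektau => [u _|//|_]; rewrite ?ltry.
move=> [Ek e0 _]; have [etau] : e + tau = 0 by move: Ektau; rewrite Ek => -[].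
have /andP[/eqP e_eq0 /eqP tau0] : (e == 0) && (tau == 0).
  by rewrite -paddr_eq0// etau.
have [] := jump k 0; first by rewrite Ek e_eq0.
  by rewrite tau0 addr0.
have -> : y_ 0 = x0 by rewrite /sampled_state /left_state tau0 eqxx lexx.
rewrite tau0 addr0 /left_state lexx => _ ->.
have [|||xgr Vxg] := jump_estimate x0 (fun=> x0) x0r (ltW Vx0).
- split => //; first by move=> ?; exact: cst_continuous.
  by move=> t; rewrite tau0 => /andP[t0 /(lt_trans t0)]; rewrite ltxx.
- by [].
- by rewrite subrr enorm0 mulr_ge0 ?enorm_ge0// subr_ge0 -expR0 ler_expR mulr_ge0.
- split=> //; apply: le_trans Vxg _.
  by rewrite ler_piMl// ltW.
Qed.

(** Strictly inside a search interval the path is continuous, so the monitored state is [x t],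
    whatever the delay. *)
Lemma not_triggered k t : (S k < t%:E)%E -> (t%:E < E k)%E -> (t%:E < T)%E ->
  V (x t) < w t.
Proof.
move=> Skt tEk tT; rewrite ltNge; apply/negP => trig.
move: (tEk); rewrite ltNge => /negP; apply; apply: event_le => //; first exact: ltW.
rewrite /monitored_state (gt_eqF Skt) andbF.
have dxt : is_derive t 1 x (f (x t)).
  apply: (is_derive_between f g V a b tau x0 T x tau_ge0 solx k) => //.
  by apply: lt_le_trans tEk _; exact: event_le_next_start.
rewrite (sampled_state_continuous f g V a b tau x0 T x tau_ge0 solx t _ _ tT dxt)//.
by rewrite -lte_fin (le_lt_trans _ Skt)// search_start_ge0.
Qed.

(** The invariant of the induction on events. Strictness below the threshold keeps the next event
    from occurring at once. *)
Definition good_start k := forall s, S k = s%:E -> (s%:E < T)%E ->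
  eball r (x s) /\ V (x s) < w s.

(** While nothing triggers, [V < w t' <= a < alpha1 r] at each time [t'], so [a] is a barrier level
    however long the search lasts; the growth estimate then applies in the ball. *)
Lemma search_phase k s t : good_start k -> S k = s%:E -> s <= t ->
  (t%:E < E k)%E -> (t%:E < T)%E ->
  [/\ eball r (x t), V (x t) < w t & V (x t) <= V (x s) * expR (mu * (t - s))].
Proof.
move=> good Sks st tEk tT.
have sT : (s%:E < T)%E by apply: le_lt_trans tT; rewrite lee_fin.
have [xsr Vxs] := good s Sks sT.
have s0 : 0 <= s by rewrite -lee_fin -Sks search_start_ge0.
have Vw t' : s <= t' <= t -> V (x t') < w t'.
  move=> /andP[+ t't]; rewrite le_eqVlt => /predU1P[<-//|st'].
  apply: (not_triggered k); rewrite ?Sks ?lte_fin//.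
    by apply: le_lt_trans tEk; rewrite lee_fin.
  by apply: le_lt_trans tT; rewrite lee_fin.
have flx : flow_on f s t x.
  split; first exact: (search_start_right_cvg f g V a b tau x0 T x tau_ge0 solx k).
  move=> t' /andP[st' t't].
  apply: (is_derive_between f g V a b tau x0 T x tau_ge0 solx k).
  - by rewrite Sks lte_fin.
  - apply: (lt_le_trans _ (event_le_next_start V a b tau x0 T x tau_ge0 k)).
    by apply: le_lt_trans tEk; rewrite lee_fin.
  - by apply: le_lt_trans tT; rewrite lee_fin.
have inball t' : s <= t' <= t -> eball r (x t').
  apply: (barrier f V alpha1 r _ _ _ s t x a) => // t'' /[dup] st'' /Vw Vt'' _.
  by apply: le_trans (ltW Vt'') _; apply: threshold_le_a; lra.
split; [by apply: inball; rewrite st lexx|by apply: Vw; rewrite st lexx|].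
exact: (growth f V mu r).
Qed.

(** An infimum equal to [t] would be attained at [t], contrary to the bound on the monitored state,
    or approached from the right, contrary to [no_trigger_right]. *)
Lemma no_event_at k t : (S k <= t%:E)%E -> (t%:E < T)%E ->
  V (monitored_state V a b tau x0 T x k t) < w t ->
  x u @[u --> t^'+] --> x t -> V (x t) < w t -> E k <> t%:E.
Proof.
move=> St tT Vmon xt Vxt Ekt.
have t0 : 0 <= t by rewrite -lee_fin -Ekt event_time_ge0.
have [d d0 Hd] := no_trigger_right f g V a b tau x0 T x tau_ge0 solx t classV
  t0 b_gt0 a_gt0 xt Vxt.
have [|t' [_ t'T]] := event_adherent V a b tau x0 T x k (t + d)%:E.
  by rewrite Ekt lte_fin ltrDl.
rewrite Ekt lte_fin lee_fin => t'd; rewrite le_eqVlt => /predU1P[<-|tt'].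
  by rewrite /triggers leNgt Vmon.
rewrite /monitored_state gt_eqF ?andbF; last first.
  by apply: le_lt_trans St _; rewrite lte_fin.
by rewrite /triggers leNgt Hd// tt'.
Qed.

Lemma search_start_lt_event k s : good_start k -> S k = s%:E -> (s%:E < T)%E ->
  (s%:E < E k)%E.
Proof.
move=> good Sks sT; have [xsr Vxs] := good s Sks sT.
rewrite lt_neqAle -{2}Sks search_start_le_event andbT; apply/negP => /eqP sE.
move: (esym sE); apply: no_event_at => //; first by rewrite Sks.
(* For [k = 0] the monitored state is [x0] or [x 0] according to the delay; [V] is below [a], the
   threshold at time 0, at both. *)
- rewrite /monitored_state Sks eqxx andbT; case: k good Sks sE => [_ [<-] _|//].
  rewrite /sampled_state /left_state lexx /threshold mulr0 expR0 mulr1.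
  have [_ Vx0] := initial_in_ball; have [_ Vx00] := initial_state.
  by case: ifP => // _; exact: le_lt_trans Vx0.
- exact: (search_start_right_cvg f g V a b tau x0 T x tau_ge0 solx k).
Qed.

(** The sampled state is the left limit at [t], so the bounds of the search phase pass to it as weak
    inequalities. *)
Lemma event_sample k s t : good_start k -> S k = s%:E -> E k = t%:E ->
  [/\ s < t, eball r (y_ t), V (y_ t) <= w t &
      V (y_ t) <= V (x s) * expR (mu * (t - s))].
Proof.
move=> good Sks Ekt.
have [t0 tT] := event_bounds tau_ge0 Ekt.
have st : s <= t by rewrite -lee_fin -Sks -Ekt search_start_le_event.
have lt_st : s < t.
  rewrite -lte_fin -Ekt; apply: search_start_lt_event => //.
  by apply: le_lt_trans tT; rewrite lee_fin.
have s0 : 0 <= s by rewrite -lee_fin -Sks search_start_ge0.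
have yt : x u @[u --> t^'-] --> y_ t.
  apply: (sampled_state_left_cvg f g V a b tau x0 T x tau_ge0 solx k) => //.
    exact: le_lt_trans lt_st.
  by rewrite Sks lte_fin.
have Vyt : V (x u) @[u --> t^'-] --> V (y_ t) by exact: class_V_cvg.
have before : \forall u \near t^'-, [/\ 0 <= u, u <= t, eball r (x u),
    V (x u) <= w u & V (x u) <= V (x s) * expR (mu * (u - s))].
  near=> u.
  have su : s < u by near: u; exact: nbhs_left_gt.
  have ut : u < t by near: u; exact: nbhs_left_lt.
  have [||xur Vw VV] := search_phase k s u good Sks (ltW su).
  - by rewrite Ekt lte_fin.
  - by apply: lt_trans tT; rewrite lte_fin.
  by split => //; lra.
have [ytr _] : eball r (y_ t) /\ V (y_ t) <= a.
  apply: (sublevel_closed V alpha1 r _ _ _ x _ _ yt a_lt) => //.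
  apply: filterS before => u [u0 _ xur Vw _]; split => //.
  exact: le_trans (threshold_le_a _ u0).
split => //.
- apply: (ler_cvg_to Vyt); last first.
    by apply: filterS before => u [_ _ _ H _]; exact: H.
  apply: cvg_at_left_filter; apply: cvgM; first exact: cvg_cst.
  apply: continuous_comp; last exact: continuous_expR.
  by apply: cvgM; [exact: cvg_cst|exact: cvg_id].
- apply: (ler_cvg_to Vyt (cvg_cst _)).
  apply: filterS before => u [_ ut _ _ H]; apply: le_trans H _.
  by rewrite ler_wpM2l// ler_expR ler_wpM2l//; lra.
Unshelve. all: by end_near. Qed.

Lemma event_sample_le_a k t : good_start k -> E k = t%:E ->
  eball r (y_ t) /\ V (y_ t) <= a.
Proof.
move=> good Ekt; have [s Sks /andP[s0 st]] := search_start_finite tau_ge0 Ekt.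
have [_ ytr Vyt _] := event_sample k s t good Sks Ekt; split => //.
by apply: le_trans Vyt _; apply: threshold_le_a; exact: le_trans st.
Qed.

Lemma is_derive_delay k t s : good_start k -> E k = t%:E ->
  t <= s < t + tau -> (s%:E < T)%E -> is_derive s 1 x (f (x s)).
Proof.
move=> good Ekt /andP[ts stau] sT.
have [s' Sks _] := search_start_finite tau_ge0 Ekt.
have [s't _ _ _] := event_sample k s' t good Sks Ekt.
apply: (is_derive_between f g V a b tau x0 T x tau_ge0 solx k) => //.
  by rewrite Sks lte_fin (lt_le_trans s't).
by rewrite /= Ekt lte_fin.
Qed.

Lemma event_delay k t s : good_start k -> E k = t%:E ->
  t <= s < t + tau -> (s%:E < T)%E ->
  eball r (x s) /\ V (x s) <= V (y_ t) * expR (mu * (s - t)).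
Proof.
move=> good Ekt tstau sT; have /andP[ts stau] := tstau.
(* Without delay the half-open interval containing [s] would be empty. *)
have tau_neq0 : tau != 0.
  by apply/eqP => tau0; move: (le_lt_trans ts stau); rewrite tau0 addr0 ltxx.
have dx u : t <= u <= s -> is_derive u 1 x (f (x u)).
  move=> /andP[tu us]; apply: (is_derive_delay k t) => //; first by lra.
  by apply: le_lt_trans sT; rewrite lee_fin.
have [] := event_sample_le_a k t good Ekt.
rewrite /sampled_state (negbTE tau_neq0) => xtr Vxt.
apply: delay_phase => //; first by lra.
split; last by move=> u /andP[tu us]; apply: dx; rewrite us ltW.
apply: cvg_at_right_filter; apply: is_derive_continuous; apply: dx.
by rewrite ts lexx.
Qed.

Lemma event_jump k t : good_start k -> E k = t%:E -> ((t + tau)%:E < T)%E ->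
  eball r (x (t + tau)) /\ V (x (t + tau)) <= rho * V (y_ t).
Proof.
move=> good Ekt tT; have [_ _ _ _ /(_ k t Ekt tT)[_ ->]] := solx.
have [ytr Vyt] := event_sample_le_a k t good Ekt.
have [t0 _] := event_bounds tau_ge0 Ekt.
case: (eqVneq tau 0) => [tau0|tau_neq0].
  have -> : left_state x0 x (t + tau) = y_ t.
    by rewrite /sampled_state tau0 eqxx addr0.
  (* Without delay the initial value problem lives on a single point, and the constant path solves
     it. *)
  apply: (jump_estimate _ (fun=> y_ t)) => //.
    split => //; first by move=> ?; exact: cst_continuous.
    by move=> u; rewrite tau0 => /andP[u0 /(lt_trans u0)]; rewrite ltxx.
  by rewrite subrr enorm0 mulr_ge0 ?enorm_ge0// subr_ge0 -expR0 ler_expR mulr_ge0.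
have tau_gt0 : 0 < tau by rewrite lt_neqAle eq_sym tau_neq0.
have dx s : t <= s < t + tau -> is_derive s 1 x (f (x s)).
  move=> /[dup] tstau /andP[ts stau]; apply: (is_derive_delay k t) => //.
  by apply: lt_trans tT; rewrite lte_fin.
move: ytr Vyt; rewrite /sampled_state (negbTE tau_neq0) => xtr Vxt.
apply: flow_delay => //.
- apply: cvg_at_right_filter; apply: is_derive_continuous; apply: dx.
  by rewrite lexx ltrDl.
- by move=> s /andP[ts stau]; apply: dx; rewrite ltW.
- apply: (left_state_cvg f g V a b tau x0 T x tau_ge0 solx) => //.
  by rewrite ltr_wpDl.
Qed.

(** Induction on [k]: the sample at an event satisfies [V <= w t], the impulse leaves at most
    [rho * w t], and [threshold_jump] puts this strictly below the threshold at [t + tau]. *)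
Lemma good_start_all k : good_start k.
Proof.
elim: k => [s [<-] _|k IH s SE sT].
  have [x0r Vx0] := initial_in_ball; have [xr Vx] := initial_state.
  split => //; apply: le_lt_trans Vx _.
  by rewrite /threshold mulr0 expR0 mulr1.
have [|t [Ekt t0 _]] := event_finite V a b tau x0 T x tau_ge0 k.
  by move: SE => /=; case: (E k) => [u _|//|_]; rewrite ?ltry.
have ts : t + tau = s by move: SE; rewrite /= Ekt => -[].
rewrite -ts in sT *; have [xr Vx] := event_jump k t IH Ekt sT.
split => //; apply: le_lt_trans Vx _.
have [s' Sks _] := search_start_finite tau_ge0 Ekt.
have [_ _ Vyt _] := event_sample k s' t IH Sks Ekt.
apply: (@le_lt_trans _ _ (rho * w t)); first by rewrite ler_pM2l.
exact: threshold_jump.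
Qed.

(* For tau = 0 the infimum could be approached only by triggering times after the
   impulse; the reset of V excludes this. *)
Lemma event_threshold k t : E k = t%:E -> V (y_ t) = w t.
Proof.
move=> Ekt; have good := good_start_all k.
have [s Sks /andP[s0 _]] := search_start_finite tau_ge0 Ekt.
have [st ytr Vyt _] := event_sample k s t good Sks Ekt.
have [_ tT] := event_bounds tau_ge0 Ekt.
apply/eqP; rewrite eq_le Vyt/= leNgt; apply/negP => Vlt.
suff [xt Vxt] : x u @[u --> t^'+] --> x t /\ V (x t) < w t.
  move: Ekt; apply: no_event_at => //; first by rewrite Sks lee_fin ltW.
  by rewrite /monitored_state Sks gt_eqF ?andbF// lte_fin.
case: (eqVneq tau 0) => [tau0|tau_neq0].
  have tE : t + tau = t by rewrite tau0 addr0.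
  have := event_jump k t good Ekt; rewrite tE => /(_ tT)[_ Vxt]; split.
    apply: (search_start_right_cvg f g V a b tau x0 T x tau_ge0 solx k.+1) => //.
    by rewrite /= Ekt -EFinD tE.
  apply: le_lt_trans Vlt; apply: le_trans Vxt _.
  by rewrite ler_piMl// ltW.
have tau_gt0 : 0 < tau by rewrite lt_neqAle eq_sym tau_neq0.
split; last by move: Vlt; rewrite /sampled_state (negbTE tau_neq0).
apply: cvg_at_right_filter; apply: is_derive_continuous.
by apply: (is_derive_delay k t) => //; rewrite lexx ltrDl.
Qed.

(** Between the impulse and the next event, [V] climbs from at most [rho * w t] to exactly [w t'] at
    rate at most [mu]; taking logarithms gives an affine inequality in t' - t. *)
Lemma event_gap k t t' : E k = t%:E -> E k.+1 = t'%:E -> gamma <= t' - t.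
Proof.
move=> Ekt Ekt'; have SE : S k.+1 = (t + tau)%:E by rewrite /= Ekt.
have good := good_start_all k; have good' := good_start_all k.+1.
have [_ t'T] := event_bounds tau_ge0 Ekt'.
have [lt_tt' _ _ Vt'] := event_sample k.+1 _ t' good' SE Ekt'.
have [_ Vjump] : eball r (x (t + tau)) /\ V (x (t + tau)) <= rho * V (y_ t).
  by apply: (event_jump k t) => //; apply: lt_trans t'T; rewrite lte_fin.
have : w t' <= rho * w t * expR (mu * (t' - (t + tau))).
  rewrite -(event_threshold k.+1)// -(event_threshold k)//.
  by apply: le_trans Vt' _; rewrite ler_wpM2r// expR_ge0.
rewrite /threshold mulrCA -mulrA ler_pM2l// -{1}[rho]lnK ?posrE//.
rewrite -!expRD ler_expR.
rewrite /dwell_time lnM ?posrE ?expR_gt0// expRK => H.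
rewrite lerBlDr -lerBlDl ler_pdivlMr ?ltr_wpDr//.
by move: H; lra.
Qed.

(** Excludes an accumulation of events. *)
Lemma event_time_ge k t : E k = t%:E -> k%:R * gamma <= t.
Proof.
elim: k t => [|k IH] t Ekt.
  by rewrite mul0r; have [] := event_bounds tau_ge0 Ekt.
have [|u [Eku _ _]] := event_finite V a b tau x0 T x tau_ge0 k.
  have := search_start_le_event V a b tau x0 T x k.+1; rewrite Ekt /=.
  by case: (E k) => [u _|//|_]; rewrite ?ltry.
have := IH u Eku; have := event_gap k u t Eku Ekt.
by rewrite -natr1; lra.
Qed.

Lemma search_interval t : 0 <= t ->
  exists k, (S k <= t%:E)%E /\ (t%:E < S k.+1)%E.
Proof.
move=> t0; have dwell_gt0 : 0 < gamma.
  apply: le_lt_trans tau_ge0 _; exact: dwell_time_gt.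
have ex_k : exists k, (t%:E < S k)%E.
  (* Since [N] exceeds [t / gamma], event [N] would come after [t]; the least index whose search
     starts after [t] is then the successor of the one sought. *)
  pose N := Num.bound (t / gamma).
  exists N.+1; rewrite ltNge; apply/negP => Et.
  have [|u [Eku u0 _]] := event_finite V a b tau x0 T x tau_ge0 N.
    apply: le_lt_trans (ltry t); apply: le_trans Et.
    exact: (event_le_next_start V a b tau x0 T x tau_ge0).
  have := event_time_ge _ _ Eku.
  have ut : u + tau <= t by rewrite -lee_fin EFinD -Eku.
  have := archi_boundP (divr_ge0 t0 (ltW dwell_gt0)); rewrite ltr_pdivrMr//.
  by move: ut tau_ge0; lra.
case: (ex_minnP ex_k) => -[|k] tSk min_k.
  by move: tSk; rewrite lte_fin ltNge t0.
exists k; split => //; rewrite leNgt; apply/negP => /min_k.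
by rewrite ltnn.
Qed.

(** During a search [V] is below the threshold itself. During a delay begun at [u], it is at most
    w(u) e^(mu (t - u)) = w(t) e^((b + mu)(t - u)), and t - u < tau. *)
Lemma trajectory_bound t : 0 <= t -> (t%:E < T)%E ->
  eball r (x t) /\ V (x t) <= w t * expR ((b + mu) * tau).
Proof.
move=> t0 tT; have [k [Skt tSk]] := search_interval t t0.
have good := good_start_all k.
case: (ltP t%:E (E k)) => [tEk|Ekt].
  have [s Sks] : exists s, S k = s%:E.
    have := search_start_ge0 V a b tau x0 T x tau_ge0 k.
    by move: Skt; case: (S k) => // s _ _; exists s.
  have st : s <= t by rewrite -lee_fin -Sks.
  have [xr /ltW Vt _] := search_phase k s t good Sks st tEk tT.
  split => //; apply: le_trans Vt _.
  rewrite ler_peMr; first by [].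
    by rewrite mulr_ge0 ?expR_ge0// ltW.
  by rewrite -expR0 ler_expR mulr_ge0// addr_ge0// ltW.
have [|u [Eku u0 _]] := event_finite V a b tau x0 T x tau_ge0 k.
  by apply: le_lt_trans Ekt _; rewrite ltry.
move: Ekt tSk; rewrite /= Eku lee_fin -EFinD lte_fin => ut tu.
have utu : u <= t < u + tau by rewrite ut.
have [xr Vt] := event_delay k u t good Eku utu tT.
split => //; apply: le_trans Vt _; rewrite (event_threshold k)// /threshold.
rewrite -!mulrA ler_pM2l// -!expRD ler_expR.
have := ler_wpM2l mu_ge0 (ltW tu); have := ler_wpM2l (ltW b_gt0) (ltW tu).
by lra.
Qed.

(** Growth at rate [mu] up to [theta] keeps [V] below [w theta], the least threshold on [0, theta],
    whereas an event at [u <= theta] would require [V] to equal [w u]. *)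
Lemma before_first_event theta t : V x0 < a * expR (- (b + mu) * theta) ->
  0 <= t <= theta -> (t%:E < T)%E -> V (x t) <= w theta.
Proof.
move=> Vx0 /andP[t0 ttheta] tT; have [_ Vx] := initial_state.
have grow u : u <= theta -> V (x 0) * expR (mu * (u - 0)) < w theta.
  move=> utheta; apply: (@le_lt_trans _ _ (V x0 * expR (mu * theta))).
    by rewrite ler_pM ?expR_ge0// ler_expR subr0 ler_wpM2l.
  apply: (@lt_le_trans _ _ (a * expR (- (b + mu) * theta) * expR (mu * theta))).
    by rewrite ltr_pM2r ?expR_gt0.
  by rewrite -mulrA -expRD ler_pM2l// ler_expR; lra.
have good := good_start_all 0.
case: (ltP t%:E (E 0)) => [tE0|E0t].
  have [_ _ Vt] := search_phase 0 0 t good erefl t0 tE0 tT.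
  by apply: le_trans Vt _; exact/ltW/grow.
have [|u [E0u u0 _]] := event_finite V a b tau x0 T x tau_ge0 0.
  by apply: le_lt_trans E0t _; rewrite ltry.
have utheta : u <= theta by apply: le_trans ttheta; rewrite -lee_fin -E0u.
have [_ _ _ Vu] := event_sample 0 0 u good erefl E0u.
have := le_lt_trans Vu (grow _ utheta); rewrite (event_threshold 0)// ltNge.
by rewrite threshold_le.
Qed.

End Trajectory.

(** * Inter-event times and asymptotic stability *)

Lemma inter_event_time x0 T x k : enorm x0 < Koo_inv alpha2 a ->
  solution f g V a b tau x0 T x ->
  (event_time V a b tau x0 T x k.+1 < +oo)%E ->
  (gamma%:E <= event_time V a b tau x0 T x k.+1
                    - event_time V a b tau x0 T x k)%E.
Proof.
move=> x0_small solx Ek1.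
have [t' [Ekt' _ _]] := event_finite V a b tau x0 T x tau_ge0 _ Ek1.
have [|t [Ekt _ _]] := event_finite V a b tau x0 T x tau_ge0 k.
  apply: le_lt_trans Ek1; apply: le_trans (search_start_le_event _ _ _ _ _ _ _ k.+1).
  exact: event_le_next_start.
rewrite Ekt Ekt' -EFinB lee_fin.
exact: event_gap Ekt Ekt'.
Qed.

Lemma threshold_vanishes (M c : R) : 0 < M -> 0 < c ->
  exists2 theta, 0 <= theta & forall t, theta <= t -> w t * M < c.
Proof.
move=> M0 c0; have aM : 0 < a * M by rewrite mulr_gt0.
(* Solves a e^(-bt) M < c for t; the added 1 makes the inequality strict. *)
exists (Num.max 0 ((ln (a * M / c) + 1) / b)); first by rewrite le_max lexx.
move=> t; rewrite ge_max => /andP[_]; rewrite ler_pdivrMr// => lt_t.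
rewrite /threshold mulrAC mulNr expRN ltr_pdivrMr ?expR_gt0// -ltr_pdivrMl//.
rewrite mulrC -[ltLHS]lnK ?posrE ?divr_gt0// ltr_expR; lra.
Qed.

Lemma V_small_enorm_small y eps : 0 <= eps -> eball r y -> V y < alpha1 eps ->
  enorm y < eps.
Proof.
move=> eps0 yr Vy; rewrite -(class_Koo_lt _ Kalpha1) ?enorm_ge0//.
exact: le_lt_trans (V_ge _ yr) Vy.
Qed.

Lemma closed_loop_asymptotically_stable :
  asymptotically_stable (solution f g V a b tau).
Proof.
pose M := expR ((b + mu) * tau).
have M1 : 1 <= M by rewrite -expR0 ler_expR mulr_ge0// addr_ge0// ltW.
have M0 : 0 < M by exact: expR_gt0.
split.
- move=> eps eps0; have c0 := class_Koo_gt0 _ Kalpha1 _ eps0.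
  have [theta theta0 Htheta] := threshold_vanishes _ _ M0 c0.
  (* After [theta] the decaying bound is already below [alpha1 eps]. Starting with [V x0 < c] leaves
     [V] at most [w theta] until then; [c <= a] keeps [x0] in the admissible ball. *)
  pose c := a * expR (- (b + mu) * theta).
  have cpos : 0 < c by rewrite mulr_gt0// expR_gt0.
  have ca : c <= a.
    rewrite ler_piMr ?(ltW a_gt0)// -expR0 ler_expR mulNr oppr_le0 mulr_ge0//.
    by rewrite addr_ge0// ltW.
  have [Kc_ge0 Kc] := class_Koo_inv_spec _ Kalpha2 _ (ltW cpos).
  have [Ka_ge0 Ka] := class_Koo_inv_spec _ Kalpha2 _ (ltW a_gt0).
  exists (Koo_inv alpha2 c); first exact: Koo_inv_gt0.
  move=> x0 T x x0c solx t t0 tT.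
  have x0_small : enorm x0 < Koo_inv alpha2 a.
    by apply: lt_le_trans x0c _; rewrite -(class_Koo_le _ Kalpha2)// Kc Ka.
  have [x0r _] := initial_in_ball x0 x0_small.
  have Vx0 : V x0 < c.
    by apply: le_lt_trans (V_le _ x0r) _; rewrite -Kc class_Koo_lt// enorm_ge0.
  have [xr Vx] := trajectory_bound _ _ _ x0_small solx t t0 tT.
  apply: V_small_enorm_small => //; first exact: ltW.
  case: (leP theta t) => [|ttheta]; first by move/Htheta; exact: le_lt_trans.
  apply: le_lt_trans (Htheta _ (lexx _)).
  apply: (@le_trans _ _ (w theta)).
    by apply: (before_first_event _ _ _ x0_small solx) => //; rewrite t0 ltW.
  by rewrite ler_peMr// mulr_ge0 ?expR_ge0// ltW.
- exists (Koo_inv alpha2 a); first exact: Koo_inv_gt0.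
  move=> x0 x x0_small solx; apply/cvgrPdist_lt => eps eps0.
  have [theta theta0 Htheta] :=
    threshold_vanishes _ _ M0 (class_Koo_gt0 _ Kalpha1 _ eps0).
  near=> t; have ttheta : theta <= t.
    by near: t; apply: nbhs_pinfty_ge; exact: num_real.
  have t0 := le_trans theta0 ttheta.
  have [xr Vx] := trajectory_bound _ _ _ x0_small solx t t0 (ltry _).
  rewrite sub0r normrN ger0_norm ?enorm_ge0//.
  apply: V_small_enorm_small => //; first exact: ltW.
  exact: le_lt_trans Vx (Htheta _ ttheta).
Unshelve. all: by end_near. Qed.

End ClosedLoop.

Theorem theorem1 (R : realType) (n : nat) (f g : 'rV[R]_n -> 'rV[R]_n)
    (V : 'rV[R]_n -> R) (alpha1 alpha2 : R -> R)
    (L1 L2 mu rho a b tau r : R) :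
  continuous f -> f 0 = 0 -> g 0 = 0 ->
  0 < a -> 0 < b -> 0 < r ->
  assumptionA f g L1 L2 r ->
  assumptionB f g tau V alpha1 alpha2 mu rho r ->
  rho < 1 -> a < alpha1 r ->
  0 <= tau ->
  tau < Num.min (mu^-1 * ln (alpha1 r / a)) (b^-1 * ln (1 / rho)) ->
  L2 + Num.sqrt (tau * L1 * (expR (2 * L1 * tau) - 1) / 2)
    < r / Koo_inv alpha1 a ->
  let Gamma := tau - ln (rho * expR (b * tau)) / (b + mu) in
  [/\ tau < Gamma,
      forall (x0 : 'rV[R]_n) (T : \bar R) (x : R -> 'rV[R]_n),
        eball (Koo_inv alpha2 a) x0 ->
        solution f g V a b tau x0 T x ->
        forall k : nat,
          (event_time V a b tau x0 T x k.+1 < +oo)%E ->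
          (Gamma%:E <= event_time V a b tau x0 T x k.+1
                       - event_time V a b tau x0 T x k)%E &
      asymptotically_stable (solution f g V a b tau)].
Proof.
move=> _ _ _ a0 b0 r0 HA HB _ a_lt tau0.
rewrite lt_min => /andP[tau_mu tau_b] jump_small Gamma.
have [_ [Kalpha1 _] mu0 rho0 _] := HB; have [L10 _ _] := HA.
have alpha1r : 0 < alpha1 r / a by rewrite divr_gt0// (lt_trans a0).
(* The first bound on the delay, in exponential form; the second one follows likewise. *)
have a_mu_tau : a * expR (mu * tau) < alpha1 r.
  rewrite mulrC -ltr_pdivlMr// -[ltRHS]lnK ?posrE// ltr_expR.
  by rewrite mulrC -ltr_pdivlMr// mulrC.
have rho_b_tau : rho * expR (b * tau) < 1.
  rewrite mulrC -ltr_pdivlMr// -[ltRHS]lnK ?posrE ?divr_gt0// ltr_expR.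
  by rewrite mulrC -ltr_pdivlMr// mulrC.
(* [expR_sub1_le_sqrt] at u = L1 tau bounds the displacement factor by the square root of the
   hypothesis. *)
have small : (L2 + (expR (L1 * tau) - 1)) * Koo_inv alpha1 a < r.
  rewrite -ltr_pdivlMr ?Koo_inv_gt0//; apply: le_lt_trans jump_small.
  rewrite lerD2l; apply: le_trans (expR_sub1_le_sqrt _ _) _.
    by rewrite mulr_ge0// ltW.
  by rewrite (mulrA 2) (mulrC tau L1).
split.
- exact: dwell_time_gt.
- move=> x0 T x x0_small solx k.
  exact: (inter_event_time f g V alpha1 alpha2 L1 L2 mu rho a b tau r a0 b0 r0
    HA HB a_lt tau0 a_mu_tau rho_b_tau small x0 T x k x0_small solx).
- exact: (closed_loop_asymptotically_stable f g V alpha1 alpha2 L1 L2 mu rho a b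
    tau r a0 b0 r0 HA HB a_lt tau0 a_mu_tau rho_b_tau small).
Qed.
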